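(* (Mean-square convergence.) Suppose Assumption 1 (i.a), (ii.a), (ii.b), (ii.c) and (iii.a) hold, with the same $\delta\in[0,1/2)$ in (ii.c) and (iii.a). Then the estimation error $e_0(t)=X(t)-\mathbf{1}_N\otimes\theta$ of the event-triggered distributed estimation algorithm satisfies $$\lim_{t\to\infty}\frac{\mathbb{E}\{\|e_0(t)\|^2\}}{\alpha^{2\delta}(t)}=0.$$
   Context: Graph: $\mathcal{G}$ is a weighted digraph on $\mathcal{V}=\{1,\dots,N\}$ with adjacency matrix $\mathcal{A}=[a_{i,j}]$, $a_{i,j}\ge0$, $a_{i,i}=0$; $a_{i,j}>0$ means a link from $j$ to $i$. $\mathcal{N}_i=\{j:a_{i,j}>0\}$ (parents of $i$), $\mathcal{N}_i^c=\{j:a_{j,i}>0\}$ (children of $i$). Laplacian $\mathcal{L}=\mathcal{D}-\mathcal{A}$, $\mathcal{D}=\mathrm{diag}\{\sum_ja_{1,j},\dots,\sum_j a_{N,j}\}$, $\bar{\mathcal{L}}=(\mathcal{L}+\mathcal{L}^{\sf T})/2$. Model: unknown $\theta\in\mathbb{R}^M$; sensor $i$ measures $y_i(t)=H_i(t)\theta+v_i(t)$, $H_i(t)\in\mathbb{R}^{m_i\times M}$ known (random), $v_i(t)\in\mathbb{R}^{m_i}$ noise. $\bar D_H(t)=\mathrm{blockdiag}\{H_1^{\sf T}(t),\dots,H_N^{\sf T}(t)\}$, $V(t)=[v_1^{\sf T}(t),\dots,v_N^{\sf T}(t)]^{\sf T}$, $\mathcal{F}(t)=\sigma(\bar D_H(s),V(s),0\le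 s\le t)$, $\mathcal{F}(-1)=\{\emptyset,\Omega\}$. Algorithm: each sensor $i$ has a deterministic fixed initial estimate $x_i(0)\in\mathbb{R}^M$, deterministic step sizes $\alpha_i(t)>0$ and thresholds $f_i(t)\ge0$. Let $\hat x_i(t)$ denote the last estimate sent by sensor $i$ up to time $t$: $\hat x_i(0)=x_i(0)$ (sensor $i$ sends at $t=0$), and for $t\ge1$, if $\|x_i(t)-\hat x_i(t-1)\|>f_i(t)$ then sensor $i$ sends (an event is triggered) and $\hat x_i(t)=x_i(t)$, otherwise $\hat x_i(t)=\hat x_i(t-1)$. The update is $$x_i(t+1)=x_i(t)+\alpha_i(t)H_i^{\sf T}(t)(y_i(t)-H_i(t)x_i(t))+\alpha_i(t)\sum_{j\in\mathcal{N}_i}a_{i,j}(\hat x_j(t)-x_i(t)).$$ $X(t)=[x_1^{\sf T}(t),\dots,x_N^{\sf T}(t)]^{\sf T}$; $f_{\max}(t)=\max_i f_i(t)$, $f_{\min}(t)=\min_i f_i(t)$. Assumption 1: (i.a) there is a deterministic sequence $\{\alpha(t)\}$ with $\alpha_i(t)/\alpha(t)\to1$ for all $i$, $\alpha(t)>0$, $\alpha(t)\to0$, $\sum_t\alpha(t)=\infty$, and $1/\alpha(t+1)-1/\alpha(t)\to\alpha_0\ge0$. (i.b) $\sum_{t}\alpha(t)^{2(1-\delta)}<\infty$ for some $\delta\in[0,1/2)$. (ii.a) $\{\bar D_H(t)\}$ and $\{V(t)\}$ are independent sequences. (ii.b) $\{V(t)\}$ is a martingale difference sequence w.r.t. $\{\mathcal{F}(t)\}$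 and for some $\rho>2$, $\sup_t\mathbb{E}\{\|V(t)\|^\rho\mid\mathcal{F}(t-1)\}=c_V<\infty$ a.s. (ii.c) $\sup_t\|\bar D_H(t)\|^2\le D<\infty$ a.s., and there exist $h\in\mathbb{N}^+$, $\lambda>0$ such that for all $m\in\mathbb{N}$ and some $\delta\in[0,1/2)$, $\lambda_{\min}\big[\sum_{t=mh}^{(m+1)h-1}\mathbb{E}\{\bar{\mathcal{L}}\otimes I_M+\bar D_H(t)\bar D_H^{\sf T}(t)\mid\mathcal{F}(mh-1)\}\big]\ge\lambda+h\alpha_0\delta$ a.s. (iii.a) $f_{\max}(t)/\alpha^\delta(t)\to0$ for some $\delta\in[0,1/2)$. (iii.b) $\sum_t\alpha(t)^{1-\delta}f_{\max}(t)<\infty$ for some $\delta\in[0,1/2)$. *)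

(* Defs.v *)
From HB Require Import structures.
From mathcomp Require Import all_boot all_order all_algebra.
From mathcomp Require Import all_classical all_reals all_analysis.
Set Implicit Arguments. Unset Strict Implicit. Unset Printing Implicit Defensive.
Import Order.TTheory GRing.Theory Num.Theory.
Import numFieldNormedType.Exports.
Local Open Scope classical_set_scope.
Local Open Scope ring_scope.

Section Defs.
Context {R : realType}.

Definition enorm (n : nat) (v : 'cV[R]_n) : R := Num.sqrt (\sum_k v k 0 ^+ 2).

(** ||A||^2 <= c for the operator (spectral) norm induced by the Euclidean norm
    (this is the literal unfolding of  sup_{x<>0} |Ax|^2/|x|^2 <= c). *)
Definition opnorm_sq_le (p q : nat) (A : 'M[R]_(p, q)) (c : R) : Prop :=
  forall x : 'cV[R]_q, enorm (A *m x) ^+ 2 <= c * enorm x ^+ 2.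

Definition lambda_min_ge (n : nat) (A : 'M[R]_n) (c : R) : Prop :=
  forall a : R, eigenvalue A a -> c <= a.

Definition laplacian (N : nat) (a : 'I_N -> 'I_N -> R) : 'M[R]_N :=
  \matrix_(i, j) ((i == j)%:R * (\sum_k a i k) - a i j).
Definition lapbar (N : nat) (a : 'I_N -> 'I_N -> R) : 'M[R]_N :=
  (2%:R)^-1 *: (laplacian a + (laplacian a)^T).

Definition kron_id (N M : nat) (B : 'M[R]_N) : 'M[R]_(\sum_(i < N) M) :=
  \mxblock_(i < N, j < N) ((B i j)%:M : 'M[R]_M).

Definition DH (N M : nat) (m : 'I_N -> nat) (H : forall i : 'I_N, 'M[R]_(m i, M))
  : 'M[R]_(\sum_(i < N) M, \sum_(j < N) m j) :=
  \mxblock_(i < N, j < N) (if i == j then (H j)^T else 0 : 'M[R]_(M, m j)).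

Definition stack (N : nat) (m : 'I_N -> nat) (v : forall i : 'I_N, 'cV[R]_(m i))
  : 'cV[R]_(\sum_(i < N) m i) := \mxcol_(i < N) v i.

(** The event-triggered distributed estimation algorithm, for a fixed sample path.
    State at time t: (x_i(t))_i and (hat x_i(t))_i. *)
Fixpoint et_state (N M : nat) (m : 'I_N -> nat) (a : 'I_N -> 'I_N -> R)
  (x0 : 'I_N -> 'cV[R]_M) (alpha f : 'I_N -> nat -> R) (theta : 'cV[R]_M)
  (H : nat -> forall i : 'I_N, 'M[R]_(m i, M)) (v : nat -> forall i : 'I_N, 'cV[R]_(m i))
  (t : nat) : ('I_N -> 'cV[R]_M) * ('I_N -> 'cV[R]_M) :=
  match t with
  | 0 => (x0, x0)
  | s.+1 =>
    let (x, xh) := @et_state N M m a x0 alpha f theta H v s in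
    let xnew := fun i : 'I_N =>
      x i + alpha i s *: ((H s i)^T *m ((H s i *m theta + v s i) - H s i *m x i))
          + alpha i s *: (\sum_(j < N | 0 < a i j) a i j *: (xh j - x i)) in
    let xhnew := fun i : 'I_N =>
      if f i s.+1 < enorm (xnew i - xh i) then xnew i else xh i in
    (xnew, xhnew)
  end.

Context {d : measure_display} {T : measurableType d}.

Definition gen_sigma (S : set (T -> R)) : set (set T) :=
  <<s [set A | exists X B, S X /\ measurable B /\ A = X @^-1` B] >>.

(** The entries of H_i(s) and v_i(s) for s < t  (i.e. s <= t-1) generate
    F(t-1) = sigma(D_H(s), V(s), 0 <= s <= t-1); for t = 0 this is the trivial
    sigma-algebra F(-1) = {emptyset, Omega}. *)
Definition filt_past (N M : nat) (m : 'I_N -> nat)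
  (H : nat -> forall i : 'I_N, T -> 'M[R]_(m i, M))
  (v : nat -> forall i : 'I_N, T -> 'cV[R]_(m i)) (t : nat) : set (set T) :=
  gen_sigma [set X | (exists s i k l, (s < t)%N /\ X = fun w => H s i w k l) \/
                     (exists s i k, (s < t)%N /\ X = fun w => v s i w k 0)].

Definition sigma_H (N M : nat) (m : 'I_N -> nat)
  (H : nat -> forall i : 'I_N, T -> 'M[R]_(m i, M)) : set (set T) :=
  gen_sigma [set X | exists s i k l, X = fun w => H s i w k l].
Definition sigma_V (N : nat) (m : 'I_N -> nat)
  (v : nat -> forall i : 'I_N, T -> 'cV[R]_(m i)) : set (set T) :=
  gen_sigma [set X | exists s i k, X = fun w => v s i w k 0].

Definition G_measurable (G : set (set T)) (Y : T -> R) : Prop :=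
  forall B : set R, measurable B -> G (Y @^-1` B).

Variable (P : probability T R).

Definition cond_exp_version (G : set (set T)) (X Y : T -> R) : Prop :=
  P.-integrable setT (fun w => (X w)%:E) /\
  P.-integrable setT (fun w => (Y w)%:E) /\ G_measurable G Y /\
  forall A, G A -> (\int[P]_(w in A) (Y w)%:E = \int[P]_(w in A) (X w)%:E)%E.

Definition cond_exp_version_nonneg (G : set (set T)) (X Y : T -> R) : Prop :=
  (forall w, 0 <= Y w) /\ G_measurable G Y /\
  forall A, G A -> (\int[P]_(w in A) (Y w)%:E = \int[P]_(w in A) (X w)%:E)%E.

Definition cond_exp_version_mx (p q : nat) (G : set (set T))
  (X Y : T -> 'M[R]_(p, q)) : Prop :=
  forall k l, cond_exp_version G (fun w => X w k l) (fun w => Y w k l).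

Definition indep_sigma (G1 G2 : set (set T)) : Prop :=
  forall A B, G1 A -> G2 B -> P (A `&` B) = (P A * P B)%E.

End Defs.

(* Main.v *)
Require Import Defs.
From HB Require Import structures.
From mathcomp Require Import all_boot all_order all_algebra finmap.
From mathcomp Require Import all_classical all_reals all_analysis.
From mathcomp Require Import measurable_realfun unstable ring lra.
Set Implicit Arguments. Unset Strict Implicit. Unset Printing Implicit Defensive.
Import Order.TTheory GRing.Theory Num.Theory.
Import numFieldNormedType.Exports.
Local Open Scope classical_set_scope.
Local Open Scope ring_scope.

(** Write e(t) for the stacked error, s(t) = E|e(t)|^2 and b(t) = alpha(t)^(2 delta).
    Up to a perturbation u(t) with |u(t)|^2 = o(1) (|e(t)|^2 + b(t)), which contains the
    triggering error, the recursion is e(t+1) = e(t) - alpha(t) G(t) e(t) + noise, where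
    G(t) = L (x) I + DH(t) DH(t)^T.  The noise is orthogonal to everything generated by
    all of H and by the past of v, because H and v are independent; hence
      s(t+1) <= s(t) - 2 alpha(t) E[e(t)^T G(t) e(t)] + o(alpha(t)) (s(t) + b(t)).
    Within a block of length h starting at T, e(t) may be replaced by e(T) in the
    quadratic term at the price of another o(1) (s(T) + b(T)); conditioning on F(T-1)
    then makes the excitation condition applicable and yields
      s(T+h) <= (1 - 2 alpha(T) (lambda + h alpha0 delta)) s(T)
                + o(alpha(T)) (s(T) + b(T)).
    Since b(T)/b(T+h) <= 1 + 2 delta h alpha0 alpha(T) + o(alpha(T)), the term
    h alpha0 delta is exactly consumed by passing to z = s/b, and
      z(T+h) <= (1 - lambda alpha(T)) z(T) + o(alpha(T)),
    which tends to 0 because the alpha(T) are not summable along the blocks. *)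

(** * Euclidean vectors and the Rayleigh quotient *)

(** The obstacle is that a single step need not contract: the Laplacian of a general digraph may
    have a quadratic form of either sign, and excitation is known only as a conditional mean over a
    block, given what precedes it. Hence the error is frozen at the block start, where it is
    measurable for that conditioning. Freezing is cheap because one increment has mean square at
    most a constant times eps^2 (s + b), so that Young's inequality with weights eps and 1/eps
    leaves a term of order eps. A single eps, valid from some time on, carries every o(1); all
    constants are fixed before eps, so that eps can be chosen last. The noise variance, of order
    alpha^2, is negligible because delta < 1/2 makes alpha = o(b). Orthogonality of the noise does
    not follow from the martingale property alone: the deterministic part of the step at time t
    contains H(t), which F(t-1) does not see. Independence is what permits conditioning on all of H.
    Conditional expectations enter only through integrals over sets, so factors are pulled out by
    approximation with simple functions. *)

Definition dotv (R : realType) n (u v : 'cV[R]_n) : R := \sum_k u k 0 * v k 0.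
Definition sqv (R : realType) n (u : 'cV[R]_n) : R := dotv u u.

Section EuclideanVectors.
Context {R : realType}.

Lemma dotvE n (u v : 'cV[R]_n) : dotv u v = (u^T *m v) 0 0.
Proof. by rewrite mxE; apply: eq_bigr => k _; rewrite mxE. Qed.

Lemma dotvC n (u v : 'cV[R]_n) : dotv u v = dotv v u.
Proof. by apply: eq_bigr => k _; rewrite mulrC. Qed.

Lemma dotvDl n (u v w : 'cV[R]_n) : dotv (u + v) w = dotv u w + dotv v w.
Proof. by rewrite -big_split; apply: eq_bigr => k _; rewrite mxE mulrDl. Qed.

Lemma dotvDr n (u v w : 'cV[R]_n) : dotv w (u + v) = dotv w u + dotv w v.
Proof. by rewrite dotvC dotvDl !(dotvC w). Qed.

Lemma dotvZl n (a : R) (u v : 'cV[R]_n) : dotv (a *: u) v = a * dotv u v.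
Proof. by rewrite mulr_sumr; apply: eq_bigr => k _; rewrite mxE mulrA. Qed.

Lemma dotvZr n (a : R) (u v : 'cV[R]_n) : dotv u (a *: v) = a * dotv u v.
Proof. by rewrite dotvC dotvZl dotvC. Qed.

Lemma dotvNl n (u v : 'cV[R]_n) : dotv (- u) v = - dotv u v.
Proof. by rewrite -scaleN1r dotvZl mulN1r. Qed.

Lemma dotvNr n (u v : 'cV[R]_n) : dotv u (- v) = - dotv u v.
Proof. by rewrite dotvC dotvNl dotvC. Qed.

Lemma dotv_mulr p n (A : 'M[R]_(p, n)) u x :
  dotv u (A *m x) = dotv (A^T *m u) x.
Proof. by rewrite !dotvE trmx_mul trmxK mulmxA. Qed.

Lemma sqv_ge0 n (u : 'cV[R]_n) : 0 <= sqv u.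
Proof. by apply: sumr_ge0 => k _; rewrite -expr2 sqr_ge0. Qed.

Lemma coord_sq_le n (u : 'cV[R]_n) k : u k 0 ^+ 2 <= sqv u.
Proof.
rewrite /sqv/dotv (bigD1 k)//= -expr2 lerDl sumr_ge0// => j _.
by rewrite -expr2 sqr_ge0.
Qed.

Lemma sqv_eq0 n (u : 'cV[R]_n) : sqv u = 0 -> u = 0.
Proof.
move=> /eqP; rewrite psumr_eq0 => [/allP u0|k _]; last by rewrite -expr2 sqr_ge0.
apply/colP => k; rewrite mxE; apply/eqP.
by have := u0 k (mem_index_enum _); rewrite mulf_eq0 orbb.
Qed.

Lemma enorm_sq n (u : 'cV[R]_n) : enorm u ^+ 2 = sqv u.
Proof.
rewrite sqr_sqrtr; first by apply: eq_bigr => k _; rewrite expr2.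
by apply: sumr_ge0 => k _; rewrite sqr_ge0.
Qed.

Lemma sqvD n (u v : 'cV[R]_n) : sqv (u + v) = sqv u + 2 * dotv u v + sqv v.
Proof. by rewrite /sqv dotvDl !dotvDr (dotvC v u); ring. Qed.

Lemma sqvN n (u : 'cV[R]_n) : sqv (- u) = sqv u.
Proof. by rewrite /sqv dotvNl dotvNr opprK. Qed.

Lemma sqvZ n (a : R) (u : 'cV[R]_n) : sqv (a *: u) = a ^+ 2 * sqv u.
Proof. by rewrite /sqv dotvZl dotvZr mulrA. Qed.

Lemma dotv_young n (eta : R) (u v : 'cV[R]_n) : 0 < eta ->
  2 * dotv u v <= eta * sqv u + eta^-1 * sqv v.
Proof.
move=> eta0; have := sqv_ge0 (eta *: u - v).
rewrite sqvD sqvZ sqvN dotvNr dotvZl => h.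
rewrite -(ler_pM2l eta0) mulrDr !mulrA mulfV ?gt_eqF// mul1r.
by rewrite -expr2; lra.
Qed.

Lemma dotv_le n (u v : 'cV[R]_n) : 2 * `|dotv u v| <= sqv u + sqv v.
Proof.
have h (w : 'cV_n) : 2 * dotv u w <= sqv u + sqv w.
  by have := dotv_young u w ltr01; rewrite invr1 !mul1r.
have := h v; have := h (- v); rewrite sqvN dotvNr.
by case: (lerP 0 (dotv u v)) => [/ger0_norm|/ltr0_norm] ->; lra.
Qed.

Lemma sqvD_le n (u v : 'cV[R]_n) : sqv (u + v) <= 2 * sqv u + 2 * sqv v.
Proof. by rewrite sqvD; have := dotv_le u v; have := ler_norm (dotv u v); lra. Qed.

Lemma dotv_CS n (u v : 'cV[R]_n) : dotv u v ^+ 2 <= sqv u * sqv v.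
Proof.
have [v0|v_neq0] := eqVneq (sqv v) 0.
  rewrite v0 mulr0 (sqv_eq0 v0) /dotv big1 ?expr0n// => k _.
  by rewrite mxE mulr0.
have v_gt0 : 0 < sqv v by rewrite lt_def v_neq0 sqv_ge0.
have := sqv_ge0 (sqv v *: u - dotv u v *: v).
rewrite sqvD sqvN !sqvZ dotvNr dotvZl dotvZr => h.
by rewrite -subr_ge0 -(pmulr_rge0 _ v_gt0); lra.
Qed.

(** The squared Frobenius norm serves as an explicit bound on the squared operator norm of the
    deterministic matrices built from the graph. *)
Definition frob p n (A : 'M[R]_(p, n)) : R := \sum_i \sum_j A i j ^+ 2.

Lemma frob_ge0 p n (A : 'M[R]_(p, n)) : 0 <= frob A.
Proof. by apply: sumr_ge0 => i _; apply: sumr_ge0 => j _; exact: sqr_ge0. Qed.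

Lemma sqv_mulmx_frobenius p n (A : 'M[R]_(p, n)) x :
  sqv (A *m x) <= frob A * sqv x.
Proof.
rewrite /frob mulr_suml; apply: ler_sum => i _; rewrite -expr2.
have -> : (A *m x) i 0 = dotv (row i A)^T x.
  by rewrite mxE; apply: eq_bigr => j _; rewrite !mxE.
apply: le_trans (dotv_CS _ _) _; apply: ler_wpM2r; first exact: sqv_ge0.
by apply: ler_sum => j _; rewrite !mxE expr2.
Qed.

(** The absolute value makes the constant nonnegative; [opnorm_sq_le] does not force this when the
    space is trivial. *)
Lemma opnorm_sq_leP p n (A : 'M[R]_(p, n)) c x :
  opnorm_sq_le A c -> sqv (A *m x) <= `|c| * sqv x.
Proof.
move=> /(_ x); rewrite !enorm_sq => /le_trans; apply.
by rewrite ler_wpM2r ?sqv_ge0// ler_norm.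
Qed.

(** Duality: the square of A^T u equals the product of u with A A^T u; Cauchy-Schwarz bounds it, and
    one factor is divided out. *)
Lemma opnorm_sq_le_tr p n (A : 'M[R]_(p, n)) c u :
  opnorm_sq_le A c -> sqv (A^T *m u) <= `|c| * sqv u.
Proof.
move=> Ac; set s := sqv _.
have [s0|s_neq0] := eqVneq s 0; first by rewrite s0 mulr_ge0// sqv_ge0.
have s_gt0 : 0 < s by rewrite lt_def s_neq0 sqv_ge0.
have sE : s = dotv u (A *m (A^T *m u)) by rewrite dotv_mulr.
have : s ^+ 2 <= sqv u * (`|c| * s).
  rewrite {1}sE; apply: le_trans (dotv_CS _ _) _.
  by rewrite ler_wpM2l ?sqv_ge0// opnorm_sq_leP.
by rewrite mulrA expr2 ler_pM2r// mulrC.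
Qed.

End EuclideanVectors.

Section Rayleigh.
Context {R : realType}.

Lemma continuous_quad n (A : 'M[R]_n) :
  continuous (fun x : 'rV[R]_n => dotv x^T (A *m x^T)).
Proof.
have -> : (fun x : 'rV[R]_n => dotv x^T (A *m x^T)) =
  (fun x => \sum_i \sum_j x 0 i * (A i j * x 0 j)).
  apply/funext => x; apply: eq_bigr => i _; rewrite mxE [(A *m _) i 0]mxE mulr_sumr.
  by apply: eq_bigr => j _; rewrite mxE.
apply: continuous_big => [|i _]; first exact: add_continuous.
apply: continuous_big => [|j _ x]; first exact: add_continuous.
apply: (@continuousM _ _ (fun y : 'rV[R]_n => y 0 i)
  (fun y : 'rV[R]_n => A i j * y 0 j)); first exact: coord_continuous.
apply: (@continuousM _ _ (fun=> A i j) (fun y : 'rV[R]_n => y 0 j)).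
  exact: cst_continuous.
exact: coord_continuous.
Qed.

Lemma unit_sphere_compact n : compact [set x : 'rV[R]_n | sqv x^T = 1].
Proof.
apply: bounded_closed_compact.
  exists 1; split => // r r1 x /= x1.
  rewrite [leLHS]/Num.norm/= mx_normrE; apply: bigmax_le; first by rewrite (le_trans _ (ltW r1)).
  move=> [i j] _ /=; rewrite (ord1 i); apply: le_trans (ltW r1).
  rewrite -(@ler_pXn2r _ 2) ?nnegrE// expr1n real_normK ?num_real// -x1.
  rewrite /sqv/dotv (bigD1 j)//= !mxE expr2 lerDl.
  by apply: sumr_ge0 => k _; rewrite -expr2 sqr_ge0.
have -> : [set x : 'rV[R]_n | sqv x^T = 1] =
   (fun x : 'rV[R]_n => dotv x^T (1%:M *m x^T)) @^-1` [set 1].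
  by apply/seteqP; split => x; rewrite /= mul1mx.
apply: preimage_closed => [x _|]; [exact: continuous_quad|exact: closed_eq].
Qed.

(** Moving from c in the direction w = B c changes the form by 2 t |w|^2 + O(t^2), which would be
    negative for small t < 0 unless w = 0. *)
Lemma quad_ge0_ker n (B : 'M[R]_n) c : B^T = B ->
  (forall x, 0 <= dotv x (B *m x)) -> dotv c (B *m c) = 0 -> B *m c = 0.
Proof.
move=> BT B0 Bc; apply: sqv_eq0; set w := B *m c.
have Bcw : dotv c (B *m w) = sqv w by rewrite dotv_mulr BT.
have b0 := B0 w; set b := dotv w (B *m w) in b0.
have q t : 0 <= 2 * t * sqv w + t ^+ 2 * b.
  have := B0 (c + t *: w).
  rewrite mulmxDr -scalemxAr !dotvDl !dotvDr !dotvZl !dotvZr Bc Bcw -/b -/w -/(sqv w).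
  by move=> h; apply: le_trans h _; lra.
apply/eqP; rewrite eq_le sqv_ge0 andbT leNgt; apply/negP => a0.
(* Near the minimiser of the parabola; the [+ 1] keeps the quotient meaningful when b = 0. *)
have := q (- (sqv w / (b + 1))); rewrite leNgt => /negP; apply.
have b1 : 0 < b + 1 by rewrite ltr_pwDr.
have -> : 2 * - (sqv w / (b + 1)) * sqv w + (- (sqv w / (b + 1))) ^+ 2 * b =
  - ((sqv w / (b + 1)) ^+ 2 * (b + 2)) by field; rewrite gt_eqF.
by rewrite oppr_lt0 mulr_gt0 ?exprn_gt0 ?divr_gt0// ltr_wpDl.
Qed.

(* A minimiser of the quadratic form on the unit sphere is an eigenvector. *)
Lemma lambda_min_quad n (A : 'M[R]_n) c x : A^T = A -> lambda_min_ge A c ->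
  c * sqv x <= dotv x (A *m x).
Proof.
move=> AT Ac.
have [x0|x_neq0] := eqVneq (sqv x) 0.
  by rewrite x0 mulr0 (sqv_eq0 x0) mulmx0 /dotv big1// => k _; rewrite mxE mul0r.
have x_gt0 : 0 < sqv x by rewrite lt_def x_neq0 sqv_ge0.
have normalize (y : 'cV[R]_n) : 0 < sqv y ->
    sqv ((Num.sqrt (sqv y))^-1 *: y) = 1.
  by move=> y0; rewrite sqvZ exprVn sqr_sqrtr ?sqv_ge0// mulVf// gt_eqF.
have ne : [set x : 'rV[R]_n | sqv x^T = 1] !=set0.
  by exists ((Num.sqrt (sqv x))^-1 *: x)^T; rewrite /= trmxK normalize.
have [u] := EVT_min_rV ne (@unit_sphere_compact n)
  (continuous_subspaceT (@continuous_quad n A)).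
rewrite inE/= => u1 umin.
set mu := dotv u^T (A *m u^T) in umin.
have Amu y : mu * sqv y <= dotv y (A *m y).
  have [y0|y_neq0] := eqVneq (sqv y) 0.
    by rewrite y0 mulr0 (sqv_eq0 y0) mulmx0 /dotv big1// => k _; rewrite mxE mul0r.
  have y_gt0 : 0 < sqv y by rewrite lt_def y_neq0 sqv_ge0.
  have := umin ((Num.sqrt (sqv y))^-1 *: y)^T.
  rewrite inE/= trmxK normalize// => /(_ erefl).
  rewrite -scalemxAr dotvZl dotvZr mulrA -expr2 exprVn sqr_sqrtr ?sqv_ge0//.
  by rewrite ler_pdivlMl// [_ * mu]mulrC.
(* A - mu is positive semidefinite and its form vanishes at the minimiser, which therefore lies in
   its kernel. *)
have : (A - mu%:M) *m u^T = 0.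
  apply: quad_ge0_ker => [|y|].
  - by rewrite linearB/= tr_scalar_mx AT.
  - by rewrite mulmxBl mul_scalar_mx dotvDr dotvNr dotvZr subr_ge0 Amu.
  - by rewrite mulmxBl mul_scalar_mx dotvDr dotvNr dotvZr -/(sqv _) u1 mulr1 subrr.
move=> /(congr1 trmx); rewrite trmx_mul trmxK linearB/= tr_scalar_mx AT trmx0.
rewrite mulmxBr mul_mx_scalar => /eqP; rewrite subr_eq0 => /eqP uA.
have u0 : u != 0.
  apply/eqP => u0; move: u1; rewrite u0 trmx0 /sqv/dotv big1; last first.
    by move=> k _; rewrite mxE mul0r.
  by move/eqP; rewrite eq_sym oner_eq0.
have cmu : c <= mu by apply: Ac; apply/eigenvalueP; exists u.
by apply: le_trans (Amu x); rewrite ler_wpM2r// sqv_ge0.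
Qed.

End Rayleigh.

(** * Real-valued expectations *)

Section Expectation.
Context {R : realType} {d : measure_display} {T : measurableType d}.
Variable P : probability T R.
Implicit Types X Y : T -> R.

Definition integ X := P.-integrable setT (fun w => (X w)%:E).
(** [fine] sends an infinite integral to 0, so the rules of calculation below ask for [integ]. *)
Definition EX X : R := fine (\int[P]_w (X w)%:E).

Lemma integ_meas X : integ X -> measurable_fun setT X.
Proof. by move=> /measurable_int/measurable_EFinP. Qed.

Lemma EXE X : integ X -> (\int[P]_w (X w)%:E = (EX X)%:E)%E.
Proof. by move=> iX; rewrite fineK//; exact: integrable_fin_num. Qed.

Lemma integ_cst c : integ (fun=> c).
Proof. exact: finite_measure_integrable_cst. Qed.

Lemma EX_cst c : EX (fun=> c) = c.
Proof. by rewrite /EX integral_cst//= probability_setT mule1. Qed.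

Lemma integD X Y : integ X -> integ Y -> integ (fun w => X w + Y w).
Proof. by move=> iX iY; exact: (integrableD _ iX iY). Qed.

Lemma EXD X Y : integ X -> integ Y -> EX (fun w => X w + Y w) = EX X + EX Y.
Proof. by move=> iX iY; exact: (RintegralD measurableT iX iY). Qed.

Lemma integZ c X : integ X -> integ (fun w => c * X w).
Proof. by move=> iX; exact: (integrableZl _ c iX). Qed.

Lemma EXZ c X : integ X -> EX (fun w => c * X w) = c * EX X.
Proof. by move=> iX; exact: (RintegralZl c measurableT iX). Qed.

Lemma integ_norm X : integ X -> integ (fun w => `|X w|).
Proof. exact: integrable_norm. Qed.

Lemma integB X Y : integ X -> integ Y -> integ (fun w => X w - Y w).
Proof. by move=> iX iY; exact: (integrableB _ iX iY). Qed.

Lemma EXB X Y : integ X -> integ Y -> EX (fun w => X w - Y w) = EX X - EX Y.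
Proof. by move=> iX iY; exact: (RintegralB measurableT iX iY). Qed.

Lemma integ_sum (I : Type) (s : seq I) (Q : pred I) (X : I -> T -> R) :
  (forall i, Q i -> integ (X i)) -> integ (fun w => \sum_(i <- s | Q i) X i w).
Proof.
move=> iX; elim: s => [|i s IH].
  by under eq_fun do rewrite big_nil; exact: integ_cst.
case: (boolP (Q i)) => [Qi|/negbTE nQi]; last first.
  by under eq_fun do rewrite big_cons nQi.
under eq_fun do rewrite big_cons Qi.
by apply: integD => //; exact: iX.
Qed.

Lemma EX_sum (I : Type) (s : seq I) (Q : pred I) (X : I -> T -> R) :
  (forall i, Q i -> integ (X i)) ->
  EX (fun w => \sum_(i <- s | Q i) X i w) = \sum_(i <- s | Q i) EX (X i).
Proof.
move=> iX; elim: s => [|i s IH].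
  by under eq_fun do rewrite big_nil; rewrite EX_cst big_nil.
rewrite big_cons; case: ifPn => [Qi|/negbTE nQi]; last first.
  by under eq_fun do rewrite big_cons nQi.
under eq_fun do rewrite big_cons Qi.
by rewrite EXD ?IH//; [exact: iX|exact: integ_sum].
Qed.

Lemma integ_le X Y : measurable_fun setT X -> integ Y ->
  {ae P, forall w, `|X w| <= Y w} -> integ X.
Proof.
move=> mX iY XY; apply/integrableP; split; first exact/measurable_EFinP.
have /integrableP[mY] := iY; apply: le_lt_trans.
apply: ae_ge0_le_integral => //.
- by apply: measurableT_comp => //; exact/measurable_EFinP.
- by apply: measurableT_comp => //.
- apply: filterS XY => w XY _ /=; rewrite lee_fin.
  exact: le_trans XY (ler_norm _).
Qed.

Lemma EX_le X Y : integ X -> integ Y -> {ae P, forall w, X w <= Y w} ->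
  EX X <= EX Y.
Proof.
move=> iX iY XY; rewrite -subr_ge0 -EXB//.
have iYX := integB iY iX; have mYX := integ_meas iYX.
(* The absolute value alters the difference only on a null set and makes it nonnegative
   everywhere. *)
have -> : EX (fun w => Y w - X w) = EX (fun w => `|Y w - X w|).
  congr fine; apply: ae_eq_integral => //.
  - exact/measurable_EFinP.
  - by apply/measurable_EFinP; exact: measurableT_comp.
  - apply: filterS XY => w XY _; congr EFin.
    by rewrite ger0_norm// subr_ge0.
by apply: fine_ge0; apply: integral_ge0 => w _; rewrite lee_fin.
Qed.

Lemma EX_ge0 X : (forall w, 0 <= X w) -> 0 <= EX X.
Proof. by move=> X0; apply: fine_ge0; apply: integral_ge0 => w _; rewrite lee_fin. Qed.

End Expectation.

(** * Pulling a measurable factor out of a vanishing conditional expectation *)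

Section PullOut.
Context {R : realType} {d : measure_display} {T : measurableType d}.
Variable P : probability T R.
Import HBNNSimple.

Variables (gens : set (set T)).
Hypothesis gens_meas : <<s gens >> `<=` measurable.
Let T' := g_sigma_algebraType gens.

Lemma sub_measurable_fun (g : T -> R) :
  measurable_fun setT (g : T' -> R) -> measurable_fun setT g.
Proof. by move=> mg _ B mB; apply: gens_meas; exact: mg. Qed.

Variable X : T -> R.
Hypotheses (iX : integ P X)
  (X0 : forall A, <<s gens >> A -> (\int[P]_(w in A) (X w)%:E = 0)%E).

Lemma pull_out_indic A : <<s gens >> A ->
  integ P (fun w => \1_A w * X w) /\ EX P (fun w => \1_A w * X w) = 0.
Proof.
move=> GA; have mA := gens_meas GA.
have E : (fun w => (\1_A w * X w)%:E) = (fun w => (X w)%:E) \_ A.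
  by rewrite epatch_indic; apply/funext => w /=; rewrite EFinM muleC.
split; rewrite /integ /EX E.
  by apply/(integrable_mkcond _ mA); apply: integrableS iX.
by rewrite -integral_mkcond X0.
Qed.

Lemma pull_out_nnsfun (g : {nnsfun T' >-> R}) :
  EX P (fun w => g w * X w) = 0.
Proof.
have E : (fun w => g w * X w) = (fun w => \sum_(y <- fset_set (range g))
    y * (\1_(g @^-1` [set y]) w * X w)).
  apply/funext => w; rewrite fimfunE fsbig_finite//= mulr_suml.
  by apply: eq_bigr => y _; rewrite mulrA.
have mg y : <<s gens >> (g @^-1` [set y]) by exact: (measurable_sfunP g).
rewrite E EX_sum => [|y _]; last by apply: integZ; exact: (pull_out_indic (mg y)).1.
by rewrite big1// => y _; rewrite EXZ ?(pull_out_indic (mg y)).2 ?mulr0//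
  (pull_out_indic (mg y)).1.
Qed.

(** Simple functions increasing to g keep the products below |g X|, so integrability of g X alone
    justifies dominated convergence, whether or not g is bounded. *)
Lemma pull_out_ge0 (g : T -> R) : measurable_fun setT (g : T' -> R) ->
  (forall w, 0 <= g w) -> integ P (fun w => g w * X w) ->
  EX P (fun w => g w * X w) = 0.
Proof.
move=> mg g0 igX.
have mg' : measurable_fun setT (EFin \o (g : T' -> R)) by exact/measurable_EFinP.
pose u n : {nnsfun T' >-> R} := nnsfun_approx measurableT mg' n.
have ucvg w : (fun n => u n w) @ \oo --> g w.
  exact: (fine_cvg (cvg_nnsfun_approx measurableT mg' (fun x _ => g0 x) (x := w) I)).
have ule n w : u n w <= g w.
  rewrite -(cvg_lim (@Rhausdorff R) (ucvg w)); apply: nondecreasing_cvgn_le.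
    by move=> m k mk; have /lefP := nd_nnsfun_approx measurableT mg' mk; apply.
  by apply/cvg_ex; exists (g w).
have mX := integ_meas iX.
have um n : measurable_fun setT (u n : T -> R) by apply: sub_measurable_fun.
have [] := @dominated_convergence _ _ _ P setT measurableT
  (fun n w => (u n w * X w)%:E) (fun w => (g w * X w)%:E)
  (fun w => `|(g w * X w)%:E|)%E.
- by move=> n; apply/measurable_EFinP; apply: measurable_funM.
- exact: measurable_int igX.
- apply: aeW => w _; apply: cvg_EFin; first exact: nearW.
  by apply: cvgMl; exact: ucvg.
- exact: integrable_abse.
- apply: aeW => w n _; rewrite lee_fin !normrM ler_wpM2r// !ger0_norm//.
move=> _ _; rewrite (EXE igX).
have -> : [sequence (\int[P]_w (u n w * X w)%:E)%E]_n = cst 0%E.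
  apply/funext => n; rewrite /mkseq/= EXE ?pull_out_nnsfun//.
  apply: integ_le (integ_norm igX) _; first exact: measurable_funM.
  by apply: aeW => w; rewrite !normrM ler_wpM2r// !ger0_norm.
by move=> /(cvg_unique _ (cvg_cst 0%E)) -/(_ (@ereal_hausdorff R))[].
Qed.

Lemma pull_out (g : T -> R) : measurable_fun setT (g : T' -> R) ->
  integ P (fun w => g w * X w) -> EX P (fun w => g w * X w) = 0.
Proof.
move=> mg igX; have mg' := sub_measurable_fun mg; have mX := integ_meas iX.
have part (h : T' -> R) : measurable_fun setT h -> (forall w, 0 <= h w <= `|g w|) ->
    integ P (fun w => h w * X w) /\ EX P (fun w => h w * X w) = 0.
  move=> mh hg; suff ih : integ P (fun w => h w * X w).
    by split => //; apply: pull_out_ge0 => // w; case/andP: (hg w).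
  apply: integ_le (integ_norm igX) _.
    by apply: measurable_funM => //; exact: sub_measurable_fun.
  apply: aeW => w; rewrite !normrM ler_wpM2r//; case/andP: (hg w) => h0 ?.
  by rewrite ger0_norm.
have [i1 e1] : integ P (fun w => Num.max (g w) 0 * X w) /\
    EX P (fun w => Num.max (g w) 0 * X w) = 0.
  apply: (part (fun w : T' => Num.max (g w) 0)); first exact: measurable_maxr.
  by move=> w; rewrite le_max lexx orbT/= ge_max normr_ge0 ler_norm.
have [i2 e2] : integ P (fun w => Num.max (- g w) 0 * X w) /\
    EX P (fun w => Num.max (- g w) 0 * X w) = 0.
  apply: (part (fun w : T' => Num.max (- g w) 0)).
    by apply: measurable_maxr => //; exact: measurable_funN.
  by move=> w; rewrite le_max lexx orbT/= ge_max normr_ge0 -normrN ler_norm.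
have -> : (fun w => g w * X w) =
    (fun w => Num.max (g w) 0 * X w - Num.max (- g w) 0 * X w).
  apply/funext => w; rewrite -mulrBl; congr (_ * _).
  by case: (lerP (g w) 0) => g0; case: (lerP (- g w) 0) => g1; lra.
by rewrite EXB// e1 e2 subrr.
Qed.

End PullOut.

(** * Noise independent of the regressors *)

Section IndependentNoise.
Context {R : realType} {d : measure_display} {T : measurableType d}.
Variable P : probability T R.
Implicit Types (X Z : T -> R) (A : set T).

Lemma integ_indic A : measurable A -> integ P (\1_A).
Proof. by move=> mA; apply: integrable_indic => //; rewrite setIT fin_num_measure. Qed.

Lemma EX_indic A : measurable A -> EX P (\1_A) = fine (P A).
Proof. by move=> mA; rewrite /EX integral_indic// setIT. Qed.

Lemma integ_restrict A X : measurable A -> integ P X ->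
  integ P (fun w => \1_A w * X w).
Proof.
move=> mA iX; apply: integ_le (integ_norm iX) _.
  by apply: measurable_funM; [exact: measurable_indic|exact: integ_meas iX].
apply: aeW => w; rewrite indicE; case: (w \in A); first by rewrite mul1r.
by rewrite mul0r normr0.
Qed.

Lemma integral_restrictE A X : measurable A -> integ P X ->
  (\int[P]_(w in A) (X w)%:E = (EX P (fun w => \1_A w * X w))%:E)%E.
Proof.
move=> mA iX; rewrite -EXE; last exact: integ_restrict.
rewrite integral_mkcond epatch_indic; apply: eq_integral => w _ /=.
by rewrite muleC -EFinM.
Qed.

Variables (gens1 gens2 gens2' : set (set T)).
Hypothesis gens1_meas : <<s gens1 >> `<=` measurable.
Hypothesis gens2_meas : <<s gens2 >> `<=` measurable.
Hypothesis gens2'_sub : <<s gens2' >> `<=` <<s gens2 >>.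
Hypothesis indep12 : indep_sigma P <<s gens1 >> <<s gens2 >>.

Variable Z : T -> R.
Hypotheses (iZ : integ P Z)
  (mZ : measurable_fun setT (Z : g_sigma_algebraType gens2 -> R))
  (Z0 : forall A, <<s gens2' >> A -> (\int[P]_(w in A) (Z w)%:E = 0)%E).

(** A generating family for the join of the two sigma-algebras that is closed under intersection, as
    the pi-lambda argument requires. *)
Definition rectangles : set (set T) :=
  [set A | exists B C, [/\ <<s gens1 >> B, <<s gens2' >> C & A = B `&` C]].

Let gsT (G : set (set T)) : <<s G >> setT.
Proof. exact: (@measurableT _ (g_sigma_algebraType G)). Qed.

Let gsI (G : set (set T)) A B : <<s G >> A -> <<s G >> B -> <<s G >> (A `&` B).
Proof. exact: (@measurableI _ (g_sigma_algebraType G)). Qed.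

Lemma sub_gens1_rectangles : <<s gens1 >> `<=` <<s rectangles >>.
Proof.
move=> B GB; apply: sub_sigma_algebra; exists B, setT.
by split => //; rewrite setIT.
Qed.

Lemma sub_gens2'_rectangles : <<s gens2' >> `<=` <<s rectangles >>.
Proof.
move=> C GC; apply: sub_sigma_algebra; exists setT, C.
by split => //; rewrite setTI.
Qed.

Lemma rectangles_meas : <<s rectangles >> `<=` measurable.
Proof.
apply: smallest_sub; first exact: sigma_algebra_measurable.
move=> _ [B [C [GB GC ->]]]; apply: measurableI; first exact: gens1_meas.
by apply: gens2_meas; exact: gens2'_sub.
Qed.

(** With b = P(B), the integrand splits into 1_C Z (1_B - b) and b 1_C Z. The second part is centred
    by hypothesis. In the first, 1_C Z is measurable for the second family and can be pulled out. *)
Lemma integral_rectangle B C : <<s gens1 >> B -> <<s gens2' >> C ->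
  EX P (fun w => \1_(B `&` C) w * Z w) = 0.
Proof.
move=> GB GC; have mB := gens1_meas GB.
have G2C := gens2'_sub GC; have mC := gens2_meas G2C.
set b := fine (P B).
have PB : P B = b%:E by rewrite fineK// fin_num_measure.
have iB : integ P (fun w => \1_B w - b).
  by apply: integB; [exact: integ_indic|exact: integ_cst].
(* Independence, read as: 1_B - P(B) has zero conditional expectation given the second family. *)
have B0 A : <<s gens2 >> A -> (\int[P]_(w in A) (\1_B w - b)%:E = 0)%E.
  move=> GA; have mA := gens2_meas GA; rewrite integral_restrictE//.
  have -> : (fun w => \1_A w * (\1_B w - b)) =
      (fun w => \1_(B `&` A) w - b * \1_A w).
    by apply/funext => w; rewrite indicI/=; ring.
  have mBA := measurableI _ _ mB mA.
  rewrite EXB ?EXZ ?EX_indic//; [|exact: integ_indic|exact: integ_indic|].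
    by rewrite indep12// fineM ?fin_num_measure// subrr.
  exact/integZ/integ_indic.
have E : (fun w => \1_(B `&` C) w * Z w) =
    (fun w => (\1_C w * Z w) * (\1_B w - b) + b * (\1_C w * Z w)).
  by apply/funext => w; rewrite indicI/=; ring.
have iCZ := integ_restrict mC iZ.
have iBCZ := integ_restrict (measurableI _ _ mB mC) iZ.
have iCZB : integ P (fun w => (\1_C w * Z w) * (\1_B w - b)).
  have -> : (fun w => (\1_C w * Z w) * (\1_B w - b)) =
      (fun w => \1_(B `&` C) w * Z w - b * (\1_C w * Z w)).
    by apply/funext => w; rewrite indicI/=; ring.
  by apply: integB => //; exact: integZ.
rewrite E EXD//; last exact: integZ.
rewrite EXZ// (pull_out gens2_meas iB B0) ?add0r//.
  have := Z0 GC; rewrite integral_restrictE// => -[->].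
  by rewrite mulr0.
by apply: measurable_funM => //; exact: measurable_indic.
Qed.

(* Z is only known to be centred given its own past; independence of the two
   families extends this to conditioning on all of the first family. *)
Lemma integral_rectangles0 A : <<s rectangles >> A ->
  (\int[P]_(w in A) (Z w)%:E = 0)%E.
Proof.
have piI : setI_closed rectangles.
  move=> _ _ [B [C [GB GC ->]]] [B' [C' [GB' GC' ->]]].
  exists (B `&` B'), (C `&` C'); split; [exact: gsI|exact: gsI|].
  by rewrite setIACA.
(* The measurable sets over which Z integrates to zero form a Dynkin class; it contains the
   rectangles, hence the sigma-algebra they generate. *)
suff : <<s rectangles >> `<=`
    [set A | measurable A /\ (\int[P]_(w in A) (Z w)%:E = 0)%E].
  by move=> /[apply] -[].
rewrite -(setI_closed_g_dynkin_g_sigma_algebra piI); apply: smallest_sub; last first.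
  move=> _ [B [C [GB GC ->]]] /=.
  have mBC : measurable (B `&` C).
    by apply: measurableI; [exact: gens1_meas|by apply: gens2_meas; exact: gens2'_sub].
  by rewrite integral_restrictE// integral_rectangle.
split => [|B [mB B0]|F tF F0].
- by split => //; exact: Z0.
- split; first exact: measurableC.
  move: B0; rewrite !integral_restrictE//; last exact: measurableC.
  move=> [B0].
  have -> : (fun w => \1_(~` B) w * Z w) = (fun w => Z w - \1_B w * Z w).
    apply/funext => w; rewrite !indicE in_setC; case: (w \in B) => /=; ring.
  rewrite EXB ?B0 ?subr0//; last exact: integ_restrict.
  by rewrite -EXE//; exact: Z0.
- have mF n : measurable (F n) by case: (F0 n).
  split; first exact: bigcupT_measurable.
  rewrite integral_bigcup//; last first.
    by apply: integrableS iZ => //; exact: bigcupT_measurable.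
  by rewrite eseries0// => n _ _; case: (F0 n).
Qed.

End IndependentNoise.

(** * The stacked error recursion *)

Section Stack.
Context {R : realType} (N : nat).
Implicit Types (m : 'I_N -> nat).

Lemma stackD m (u v : forall i, 'cV[R]_(m i)) :
  stack u + stack v = stack (fun i => u i + v i).
Proof. by rewrite /stack mxcolD. Qed.

Lemma stackN m (u : forall i, 'cV[R]_(m i)) : - stack u = stack (fun i => - u i).
Proof. by rewrite /stack mxcolN. Qed.

Lemma stackZ m c (u : forall i, 'cV[R]_(m i)) : c *: stack u = stack (fun i => c *: u i).
Proof. by apply/matrixP => k l; rewrite !mxE. Qed.

Lemma eq_stack m (u v : forall i, 'cV[R]_(m i)) : (forall i, u i = v i) ->
  stack u = stack v.
Proof. exact: eq_mxcol. Qed.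

Lemma dotv_stack m (u v : forall i, 'cV[R]_(m i)) :
  dotv (stack u) (stack v) = \sum_i dotv (u i) (v i).
Proof.
rewrite dotvE tr_mxcol mul_mxrow_mxcol summxE.
by apply: eq_bigr => i _; rewrite dotvE.
Qed.

Lemma sqv_stack m (u : forall i, 'cV[R]_(m i)) : sqv (stack u) = \sum_i sqv (u i).
Proof. exact: dotv_stack. Qed.

Lemma sqv_stack_scale m (u : forall i, 'cV[R]_(m i)) (c : 'I_N -> R) b :
  (forall i, `|c i| <= b) -> sqv (stack (fun i => c i *: u i)) <= b ^+ 2 * sqv (stack u).
Proof.
move=> cb; rewrite !sqv_stack mulr_sumr; apply: ler_sum => i _.
rewrite sqvZ ler_wpM2r ?sqv_ge0// -[c i ^+ 2]real_normK ?num_real//.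
by rewrite ler_pXn2r ?nnegrE// (le_trans _ (cb i)).
Qed.

Lemma kron_id_stack M (B : 'M[R]_N) (u : 'I_N -> 'cV[R]_M) :
  kron_id M B *m stack u = stack (fun i => \sum_j B i j *: u j).
Proof.
rewrite /kron_id /stack mul_mxblock_mxrow; apply: eq_mxcol => i.
by apply: eq_bigr => j _; rewrite mul_scalar_mx.
Qed.

Lemma kron_id_lapbar M (a : 'I_N -> 'I_N -> R) :
  kron_id M (lapbar a) =
  2^-1 *: (kron_id M (laplacian a) + (kron_id M (laplacian a))^T).
Proof.
rewrite /kron_id tr_mxblock -mxblockD; apply/matrixP => k l; rewrite !mxE.
by rewrite [tagnat.sig2 l == _]eq_sym -mulrnDl mulrnAr.
Qed.

(** A quadratic form sees only the symmetric part. This links the excitation condition, stated for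
    the symmetrised Laplacian, to the recursion, driven by the Laplacian itself. *)
Lemma dotv_kron_lapbar M (a : 'I_N -> 'I_N -> R) x :
  dotv x (kron_id M (lapbar a) *m x) = dotv x (kron_id M (laplacian a) *m x).
Proof.
rewrite kron_id_lapbar -scalemxAl mulmxDl dotvZr dotvDr.
by rewrite [dotv x (_^T *m x)]dotv_mulr trmxK [dotv _ x]dotvC; lra.
Qed.

Lemma DH_stack M m (H : forall i : 'I_N, 'M[R]_(m i, M)) (u : forall i, 'cV[R]_(m i)) :
  DH H *m stack u = stack (fun i => (H i)^T *m u i).
Proof.
rewrite /DH /stack mul_mxblock_mxrow; apply: eq_mxcol => i.
rewrite (bigD1 i)//= eqxx big1 ?addr0// => j.
by rewrite eq_sym => /negbTE ->; rewrite mul0mx.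
Qed.

Lemma DH_tr_stack M m (H : forall i : 'I_N, 'M[R]_(m i, M)) (u : 'I_N -> 'cV[R]_M) :
  (DH H)^T *m stack u = stack (fun i => H i *m u i).
Proof.
rewrite /DH /stack tr_mxblock mul_mxblock_mxrow; apply: eq_mxcol => i.
rewrite (bigD1 i)//= eqxx trmxK big1 ?addr0// => j.
by move=> /negbTE ->; rewrite trmx0 mul0mx.
Qed.

End Stack.

Section ErrorDynamics.
Context {R : realType} (N M : nat) (m : 'I_N -> nat).
Variables (a : 'I_N -> 'I_N -> R) (x0 : 'I_N -> 'cV[R]_M).
Variables (alphai f : 'I_N -> nat -> R) (theta : 'cV[R]_M).
Variables (H : nat -> forall i : 'I_N, 'M[R]_(m i, M)).
Variables (v : nat -> forall i : 'I_N, 'cV[R]_(m i)).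
Hypothesis ha_ge0 : forall i j, 0 <= a i j.
Hypothesis hf_ge0 : forall i t, 0 <= f i t.

Let st := et_state a x0 alphai f theta H v.

Definition error (t : nat) : 'cV[R]_(\sum_(i < N) M) :=
  stack (fun i => (st t).1 i - theta).

Definition trigger_gap (t : nat) (j : 'I_N) : 'cV[R]_M := (st t).2 j - (st t).1 j.

Definition gain (t : nat) : 'M[R]_(\sum_(i < N) M) :=
  kron_id M (laplacian a) + DH (H t) *m (DH (H t))^T.

Definition drift (t : nat) (i : 'I_N) : 'cV[R]_M :=
  - ((H t i)^T *m (H t i *m ((st t).1 i - theta))) +
  \sum_(j < N | 0 < a i j) a i j *: ((st t).2 j - (st t).1 i).

Definition trigger_pull (t : nat) : 'cV[R]_(\sum_(i < N) M) :=
  kron_id M (\matrix_(i, j) a i j) *m stack (trigger_gap t).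

Definition noise_kick (t : nat) : 'cV[R]_(\sum_(i < N) M) :=
  stack (fun i => alphai i t *: ((H t i)^T *m v t i)).

Lemma laplacian_sum (e : 'I_N -> 'cV[R]_M) i :
  \sum_j laplacian a i j *: e j = \sum_j a i j *: (e i - e j).
Proof.
under eq_bigr do rewrite mxE scalerBl.
under [RHS]eq_bigr do rewrite scalerBr.
rewrite !sumrB; congr (_ - _).
rewrite (bigD1 i)//= eqxx mul1r scaler_suml [X in _ + X]big1 ?addr0// => j.
by rewrite eq_sym => /negbTE ->; rewrite mul0r scale0r.
Qed.

(** Each transmitted estimate is the current one plus its gap. The differences of current estimates,
    from which theta cancels, form the Laplacian term, and the gaps form [trigger_pull]. *)
Lemma drift_stack t : stack (drift t) = - (gain t *m error t) + trigger_pull t.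
Proof.
rewrite /gain mulmxDl /trigger_pull /error -mulmxA DH_tr_stack DH_stack !kron_id_stack.
rewrite stackD stackN stackD; apply: eq_stack => i.
rewrite laplacian_sum /drift opprD [X in _ = X + _]addrC -addrA; congr (_ + _).
(* The sum over parents extends to all sensors because the added weights are zero. *)
rewrite -sumrN -big_split/= big_mkcond/=; apply: eq_bigr => j _.
rewrite mxE /trigger_gap; case: ltP => [_|].
  by apply/matrixP => k l; rewrite !mxE; ring.
move=> aij; have -> : a i j = 0 by apply/eqP; rewrite eq_le aij ha_ge0.
by rewrite !scale0r oppr0 addr0.
Qed.

(** After a transmission the gap is zero, and this includes time 0; otherwise the triggering test
    has just failed, which is the bound. *)
Lemma trigger_gap_le t j : sqv (trigger_gap t j) <= f j t ^+ 2.
Proof.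
rewrite /trigger_gap /st; case: t => [|t] /=.
  by rewrite subrr -(scale0r 0) sqvZ expr0n mul0r sqr_ge0.
case: (et_state _ _ _ _ _ _ _ t) => x xh /=; case: ltP => [_|fle].
  by rewrite subrr -(scale0r 0) sqvZ expr0n mul0r sqr_ge0.
rewrite -opprB sqvN -enorm_sq ler_pXn2r ?nnegrE// ?sqrtr_ge0 //.
Qed.

Lemma error_step t :
  error t.+1 = error t + stack (fun i => alphai i t *: drift t i) + noise_kick t.
Proof.
rewrite /error /noise_kick !stackD; apply: eq_stack => i.
rewrite /drift /st /=; case: (et_state _ _ _ _ _ _ _ t) => x xh /=.
rewrite !(mulmxBr, mulmxDr) ?mulmxN.
move: ((H t i)^T *m (H t i *m theta)) ((H t i)^T *m (H t i *m x i)) => p q.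
move: ((H t i)^T *m v t i) (\sum_(j < N | 0 < a i j) _) => r s.
by apply/matrixP => k l; rewrite !mxE; ring.
Qed.

Variables (D : R) (t : nat).
Hypothesis hDH : opnorm_sq_le (DH (H t)) D.

Definition gain_bound : R := 2 * frob (kron_id M (laplacian a)) + 2 * D ^+ 2.
Definition pull_bound : R := frob (kron_id M (\matrix_(i, j) a i j)) * N%:R.

Lemma gain_bound_ge0 : 0 <= gain_bound.
Proof. by rewrite addr_ge0// mulr_ge0// ?frob_ge0// sqr_ge0. Qed.

Lemma pull_bound_ge0 : 0 <= pull_bound.
Proof. by rewrite mulr_ge0// frob_ge0. Qed.

Lemma gain_le x : sqv (gain t *m x) <= gain_bound * sqv x.
Proof.
rewrite mulmxDl; apply: le_trans (sqvD_le _ _) _.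
rewrite /gain_bound [leRHS]mulrDl -!mulrA lerD// ler_pM2l//; first exact: sqv_mulmx_frobenius.
rewrite -mulmxA; apply: le_trans (opnorm_sq_leP _ hDH) _.
rewrite mulrA -expr2 -[D ^+ 2]real_normK ?num_real// expr2 -mulrA ler_wpM2l//.
exact: opnorm_sq_le_tr.
Qed.

Lemma trigger_pull_le phi : (forall j, f j t <= phi) ->
  sqv (trigger_pull t) <= pull_bound * phi ^+ 2.
Proof.
move=> fphi; apply: le_trans (sqv_mulmx_frobenius _ _) _.
rewrite /pull_bound -mulrA ler_wpM2l ?frob_ge0// sqv_stack.
have -> : N%:R * phi ^+ 2 = \sum_(i < N) phi ^+ 2 :> R.
  by rewrite sumr_const card_ord mulr_natl.
apply: ler_sum => j _; apply: le_trans (trigger_gap_le _ _) _.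
by rewrite ler_pXn2r ?nnegrE// (le_trans _ (fphi j)).
Qed.

Lemma noise_kick_le al : 0 < al -> (forall i, `|alphai i t| <= 2 * al) ->
  sqv (noise_kick t) <= 4 * `|D| * al ^+ 2 * sqv (stack (v t)).
Proof.
move=> al0 hal; apply: le_trans (sqv_stack_scale _ hal) _.
rewrite -DH_stack; have -> : 4 * `|D| * al ^+ 2 * sqv (stack (v t)) =
  (2 * al) ^+ 2 * (`|D| * sqv (stack (v t))) by ring.
by rewrite ler_wpM2l ?sqr_ge0//; exact: opnorm_sq_leP.
Qed.

Variables (al : R) (al0 : 0 < al).

(* The step direction is [- gain * error] up to this term, which collects the
   triggering error and the mismatch between the individual step sizes. *)
Definition perturbation : 'cV[R]_(\sum_(i < N) M) :=
  trigger_pull t + stack (fun i => (alphai i t / al - 1) *: drift t i).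

Lemma error_step_perturbation :
  error t.+1 = error t + al *: (- (gain t *m error t) + perturbation) + noise_kick t.
Proof.
rewrite error_step /perturbation addrA -drift_stack [X in al *: X]stackD stackZ.
congr (_ + _ + _); apply: eq_stack => i.
rewrite scalerBl scale1r addrC subrK scalerA mulrC divfK// gt_eqF//.
Qed.

(** The mismatch of step sizes multiplies the drift by at most eps, and the drift is again gain plus
    pull. Applying |u + v|^2 <= 2|u|^2 + 2|v|^2 twice gives 4 for the gain and 2 + 4 for the
    pull. *)
Lemma perturbation_le eps beta : 0 < eps -> eps <= 1 -> 0 <= beta ->
  (forall i, `|alphai i t / al - 1| <= eps) ->
  (forall j, f j t ^+ 2 <= eps ^+ 2 * beta) ->
  sqv perturbation <=
  eps ^+ 2 * ((4 * gain_bound + 6 * pull_bound) * (sqv (error t) + beta)).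
Proof.
move=> eps0 eps1 beta0 hal hfe.
have eb0 : 0 <= eps ^+ 2 * beta by rewrite mulr_ge0// sqr_ge0.
have hW : sqv (trigger_pull t) <= pull_bound * (eps ^+ 2 * beta).
  rewrite -[eps ^+ 2 * beta]sqr_sqrtr//; apply: trigger_pull_le => j.
  by rewrite -(@ler_pXn2r _ 2) ?nnegrE ?sqrtr_ge0 ?hf_ge0// sqr_sqrtr.
apply: le_trans (sqvD_le _ _) _.
have hB : sqv (stack (drift t)) <=
    2 * (gain_bound * sqv (error t)) + 2 * (pull_bound * beta).
  rewrite drift_stack; apply: le_trans (sqvD_le _ _) _.
  rewrite sqvN lerD// ler_pM2l//; first exact: gain_le.
  apply: le_trans hW _; rewrite ler_wpM2l ?pull_bound_ge0//.
  by rewrite ler_piMl// exprn_ile1// ltW.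
have hS := sqv_stack_scale (drift t) hal.
have := ler_wpM2l (sqr_ge0 eps) hB.
have g0 : 0 <= eps ^+ 2 * (gain_bound * beta).
  by rewrite (mulr_ge0 (sqr_ge0 _) (mulr_ge0 gain_bound_ge0 beta0)).
have p0 : 0 <= eps ^+ 2 * (pull_bound * sqv (error t)).
  by rewrite (mulr_ge0 (sqr_ge0 _) (mulr_ge0 pull_bound_ge0 (sqv_ge0 _))).
nra.
Qed.

End ErrorDynamics.

(** * Measurability and square integrability *)

Section MeasurableVectors.
Context {R : realType} {d : measure_display} {T : measurableType d}.

Definition mxmeas p q (A : T -> 'M[R]_(p, q)) :=
  forall k l, measurable_fun setT (fun w => A w k l).

Lemma mxmeas_cst p q (A : 'M[R]_(p, q)) : mxmeas (fun=> A).
Proof. by move=> k l; exact: measurable_cst. Qed.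

Lemma mxmeasD p q (A B : T -> 'M[R]_(p, q)) :
  mxmeas A -> mxmeas B -> mxmeas (fun w => A w + B w).
Proof.
by move=> mA mB k l; under eq_fun do rewrite mxE; exact: measurable_funD.
Qed.

Lemma mxmeasZ p q c (A : T -> 'M[R]_(p, q)) : mxmeas A -> mxmeas (fun w => c *: A w).
Proof.
by move=> mA k l; under eq_fun do rewrite mxE; exact: measurable_funM.
Qed.

Lemma mxmeasN p q (A : T -> 'M[R]_(p, q)) : mxmeas A -> mxmeas (fun w => - A w).
Proof.
by move=> mA k l; under eq_fun do rewrite mxE; exact: measurable_funN.
Qed.

Lemma mxmeasB p q (A B : T -> 'M[R]_(p, q)) :
  mxmeas A -> mxmeas B -> mxmeas (fun w => A w - B w).
Proof. by move=> mA mB; exact/mxmeasD/mxmeasN. Qed.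

Lemma mxmeas_tr p q (A : T -> 'M[R]_(p, q)) : mxmeas A -> mxmeas (fun w => (A w)^T).
Proof. by move=> mA k l; under eq_fun do rewrite mxE; exact: mA. Qed.

Lemma mxmeas_mul p q r (A : T -> 'M[R]_(p, q)) (B : T -> 'M[R]_(q, r)) :
  mxmeas A -> mxmeas B -> mxmeas (fun w => A w *m B w).
Proof.
move=> mA mB k l; under eq_fun do rewrite mxE.
by apply: measurable_sum => i; exact: measurable_funM.
Qed.

Lemma mxmeas_sum p q (I : Type) (s : seq I) (Q : pred I) (A : I -> T -> 'M[R]_(p, q)) :
  (forall i, mxmeas (A i)) -> mxmeas (fun w => \sum_(i <- s | Q i) A i w).
Proof.
move=> mA k l; under eq_fun do rewrite summxE big_mkcond.
by apply: measurable_sum => i; case: (Q i); [exact: mA|exact: measurable_cst].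
Qed.

Lemma measurable_dotv n (u v : T -> 'cV[R]_n) : mxmeas u -> mxmeas v ->
  measurable_fun setT (fun w => dotv (u w) (v w)).
Proof. by move=> mu mv; apply: measurable_sum => k; exact: measurable_funM. Qed.

Lemma measurable_enorm n (u : T -> 'cV[R]_n) : mxmeas u ->
  measurable_fun setT (fun w => enorm (u w)).
Proof.
move=> mu; apply: (@measurableT_comp _ _ _ _ _ _ (@Num.sqrt R)).
  by apply: continuous_measurable_fun; exact: sqrt_continuous.
by apply: measurable_sum => k; exact: measurable_funX.
Qed.

Lemma mxmeas_stack N (m : 'I_N -> nat) (u : forall i, T -> 'cV[R]_(m i)) :
  (forall i, mxmeas (u i)) -> mxmeas (fun w => stack (fun i => u i w)).
Proof. by move=> mu k l; under eq_fun do rewrite mxE; exact: mu. Qed.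

Lemma mxmeas_DH N M (m : 'I_N -> nat) (H : forall i, T -> 'M[R]_(m i, M)) :
  (forall i, mxmeas (H i)) -> mxmeas (fun w => DH (fun i => H i w)).
Proof.
move=> mH k l; under eq_fun do rewrite mxE.
case: eqP => _; last by under eq_fun do rewrite mxE; exact: measurable_cst.
by under eq_fun do rewrite mxE; exact: mH.
Qed.

End MeasurableVectors.

Section MeasurableState.
Context {R : realType} {d : measure_display} {T : measurableType d}.
Context (N M : nat) (m : 'I_N -> nat).
Variables (a : 'I_N -> 'I_N -> R) (x0 : 'I_N -> 'cV[R]_M).
Variables (alphai f : 'I_N -> nat -> R) (theta : 'cV[R]_M).
Variables (H : nat -> forall i : 'I_N, T -> 'M[R]_(m i, M)).
Variables (v : nat -> forall i : 'I_N, T -> 'cV[R]_(m i)).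

Let st t w := et_state a x0 alphai f theta (fun s j => H s j w) (fun s j => v s j w) t.

(** Only data before t are required, and [T] may carry any sigma-algebra. The same lemma thus yields
    measurability in the ambient space and adaptedness to each of the smaller sigma-algebras. *)
Lemma mxmeas_state t : (forall s i, (s < t)%N -> mxmeas (H s i)) ->
  (forall s i, (s < t)%N -> mxmeas (v s i)) ->
  forall i, mxmeas (fun w => (st t w).1 i) /\ mxmeas (fun w => (st t w).2 i).
Proof.
elim: t => [|t IH] mH mv; first by move=> i; split; exact: mxmeas_cst.
have {}IH := IH (fun s i st => mH s i (ltnW st)) (fun s i st => mv s i (ltnW st)).
have {}mH := mH t _ (ltnSn t); have {}mv := mv t _ (ltnSn t).
have mx i := (IH i).1; have mxh i := (IH i).2.
pose xnew w i := (st t w).1 i + alphai i t *: ((H t i w)^T *m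
    ((H t i w *m theta + v t i w) - H t i w *m (st t w).1 i))
    + alphai i t *: (\sum_(j < N | 0 < a i j) a i j *: ((st t w).2 j - (st t w).1 i)).
have stE w : st t.+1 w = (xnew w, fun i =>
    if f i t.+1 < enorm (xnew w i - (st t w).2 i) then xnew w i else (st t w).2 i).
  by rewrite /xnew /st /=; case: (et_state _ _ _ _ _ _ _ _).
have mxnew i : mxmeas (fun w => xnew w i).
  apply: mxmeasD; first apply: mxmeasD => //; apply: mxmeasZ.
    apply: mxmeas_mul; first exact: mxmeas_tr.
    apply: mxmeasB; last exact: mxmeas_mul.
    by apply: mxmeasD => //; apply: mxmeas_mul => //; exact: mxmeas_cst.
  by apply: mxmeas_sum => j; apply: mxmeasZ; exact: mxmeasB.
move=> i; split => k l; under eq_fun do rewrite stE/=; first exact: mxnew.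
under eq_fun do rewrite (fun_if (fun A : 'cV_M => A k l)).
apply: measurable_fun_ifT; [|exact: mxnew|exact: mxh].
by apply: measurable_fun_ltr => //; apply: measurable_enorm; exact: mxmeasB.
Qed.

End MeasurableState.

Section SquareIntegrable.
Context {R : realType} {d : measure_display} {T : measurableType d}.
Variable P : probability T R.

Definition vL2 n (u : T -> 'cV[R]_n) := mxmeas u /\ integ P (fun w => sqv (u w)).

Lemma measurable_sqv n (u : T -> 'cV[R]_n) : mxmeas u ->
  measurable_fun setT (fun w => sqv (u w)).
Proof. by move=> mu; exact: measurable_dotv. Qed.

Lemma vL2_le n (u : T -> 'cV[R]_n) (Y : T -> R) : mxmeas u -> integ P Y ->
  {ae P, forall w, sqv (u w) <= Y w} -> vL2 u.
Proof.
move=> mu iY uY; split => //; apply: integ_le iY _; first exact: measurable_sqv.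
by apply: filterS uY => w; rewrite ger0_norm// sqv_ge0.
Qed.

Lemma vL2D n (u v : T -> 'cV[R]_n) : vL2 u -> vL2 v -> vL2 (fun w => u w + v w).
Proof.
move=> [mu iu] [mv iv]; apply: vL2_le.
- exact: mxmeasD.
- exact: (integD (integZ 2 iu) (integZ 2 iv)).
- by apply: aeW => w; exact: sqvD_le.
Qed.

Lemma vL2N n (u : T -> 'cV[R]_n) : vL2 u -> vL2 (fun w => - u w).
Proof.
move=> [mu iu]; apply: (vL2_le _ iu); first exact: mxmeasN.
by apply: aeW => w; rewrite sqvN.
Qed.

Lemma vL2_mul p n (A : T -> 'M[R]_(p, n)) c (u : T -> 'cV[R]_n) : mxmeas A ->
  {ae P, forall w, forall x, sqv (A w *m x) <= c * sqv x} -> vL2 u ->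
  vL2 (fun w => A w *m u w).
Proof.
move=> mA Ac [mu iu]; apply: (vL2_le _ (integZ c iu)); first exact: mxmeas_mul.
by apply: filterS Ac => w; exact.
Qed.

Lemma vL2_mul_cst p n (A : 'M[R]_(p, n)) (u : T -> 'cV[R]_n) : vL2 u ->
  vL2 (fun w => A *m u w).
Proof.
apply: vL2_mul; first exact: mxmeas_cst.
by apply: aeW => w x; exact: sqv_mulmx_frobenius.
Qed.

Lemma integ_dotv n (u v : T -> 'cV[R]_n) : vL2 u -> vL2 v ->
  integ P (fun w => dotv (u w) (v w)).
Proof.
move=> [mu iu] [mv iv]; apply: integ_le (integD iu iv) _.
  exact: measurable_dotv.
apply: aeW => w; have := dotv_le (u w) (v w).
by have := normr_ge0 (dotv (u w) (v w)); lra.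
Qed.

Lemma integ_coord_mul n (u v : T -> 'cV[R]_n) k : vL2 u -> vL2 v ->
  integ P (fun w => u w k 0 * v w k 0).
Proof.
move=> [mu iu] [mv iv]; apply: integ_le (integD iu iv) _.
  exact: measurable_funM.
apply: aeW => w; have := coord_sq_le (u w) k; have := coord_sq_le (v w) k; rewrite normrM.
rewrite -(real_normK (num_real (u w k 0))) -(real_normK (num_real (v w k 0))).
by have := sqr_ge0 (`|u w k 0| - `|v w k 0|); nra.
Qed.

End SquareIntegrable.

(** * Mean-square estimates along the algorithm *)

Section GeneratedSigma.
Context {R : realType} {d : measure_display} {T : measurableType d}.
Implicit Types S : set (T -> R).

Definition preimages S : set (set T) :=
  [set A | exists X B, S X /\ measurable B /\ A = X @^-1` B].

Lemma gen_sigma_sub S : (forall X, S X -> measurable_fun setT X) ->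
  <<s preimages S >> `<=` measurable.
Proof.
move=> mS; apply: smallest_sub; first exact: sigma_algebra_measurable.
by move=> _ [X [B [SX [mB ->]]]]; rewrite -[X @^-1` B]setTI; exact: mS.
Qed.

Lemma preimages_sub S S' : S `<=` S' -> <<s preimages S >> `<=` <<s preimages S' >>.
Proof.
move=> SS'; apply: sub_sigma_algebra2 => _ [X [B [SX [mB ->]]]].
by exists X, B; split => //; exact: SS'.
Qed.

Lemma measurable_preimages S X (G : set (set T)) : S X ->
  <<s preimages S >> `<=` <<s G >> ->
  measurable_fun setT (X : g_sigma_algebraType G -> R).
Proof.
move=> SX SG _ B mB; rewrite setTI; apply: SG; apply: sub_sigma_algebra.
by exists X, B.
Qed.

End GeneratedSigma.

(** * Testing a conditional expectation against a square-integrable vector *)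

Section Truncation.
Context {R : realType} {d : measure_display} {T : measurableType d}.
Variable P : probability T R.

Lemma EX_truncation_ge0 (S F : T -> R) : measurable_fun setT S -> integ P F ->
  (forall n : nat, 0 <= EX P (fun w => \1_[set x | S x <= n%:R] w * F w)) ->
  0 <= EX P F.
Proof.
move=> mS iF F0; pose A n := [set x | S x <= n%:R].
have mA n : measurable (A n).
  by rewrite -[A n]setTI; apply: measurable_fun_le => //; exact: measurable_cst.
have mF := integ_meas iF.
have [] := @dominated_convergence _ _ _ P setT measurableT
  (fun n w => (\1_(A n) w * F w)%:E) (fun w => (F w)%:E) (fun w => (`|F w|)%:E).
- move=> n; apply/measurable_EFinP; by apply: measurable_funM.
- exact/measurable_EFinP.
- apply: aeW => w _; apply: cvg_near_cst.
  near=> n; rewrite indicE mem_set ?mul1r//.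
  rewrite /A/= (le_trans (ler_norm _))//.
  by near: n; exact: nbhs_infty_ger.
- exact: integ_norm.
- apply: aeW => w n _; rewrite lee_fin normrM indicE.
  by case: (w \in A n) => /=; rewrite ?normr1 ?mul1r// normr0 mul0r.
move=> _ _; rewrite (EXE iF) => cF; rewrite -lee_fin.
apply: (cvge_ge _ cF).
apply: nearW => n; rewrite /mkseq/= EXE ?lee_fin; first exact: F0.
exact: integ_restrict.
Unshelve. all: by end_near. Qed.

Lemma dotv_mulmx_sum n (A : 'M[R]_n) (e : 'cV[R]_n) :
  dotv e (A *m e) = \sum_k \sum_l (e k 0 * e l 0) * A k l.
Proof.
apply: eq_bigr => k _; rewrite mxE mulr_sumr; apply: eq_bigr => l _; ring.
Qed.

(* The conditional expectation of A can only be tested against bounded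
   G-measurable weights, hence the truncation of e. *)
Lemma conditional_quad_ge n (gens : set (set T)) (A B : T -> 'M[R]_n)
    (e : T -> 'cV[R]_n) c :
  <<s gens >> `<=` measurable ->
  (forall k l, integ P (fun w => A w k l - B w k l)) ->
  (forall k l S, <<s gens >> S -> (\int[P]_(w in S) (A w k l - B w k l)%:E = 0)%E) ->
  mxmeas (e : g_sigma_algebraType gens -> _) ->
  integ P (fun w => sqv (e w)) -> integ P (fun w => dotv (e w) (A w *m e w)) ->
  {ae P, forall w x, c * sqv x <= dotv x (B w *m x)} ->
  c * EX P (fun w => sqv (e w)) <= EX P (fun w => dotv (e w) (A w *m e w)).
Proof.
move=> gm iAB AB0 me ie iAe Bc.
rewrite -subr_ge0 -EXZ// -EXB//; last exact: integZ.
have ice := integZ c ie; have iF := integB iAe ice.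
have mS : measurable_fun setT (fun w : g_sigma_algebraType gens => sqv (e w)).
  exact: measurable_dotv.
have mS' := sub_measurable_fun gm mS.
apply: (EX_truncation_ge0 mS' iF) => q.
set Q := [set x | sqv (e x) <= q%:R].
have GQ : <<s gens >> Q.
  have : measurable [set x : g_sigma_algebraType gens | sqv (e x) <= q%:R].
    by rewrite -[X in measurable X]setTI; apply: measurable_fun_le => //; exact: measurable_cst.
  by [].
have mQ := gm _ GQ.
pose g k l w := \1_Q w * (e w k 0 * e w l 0).
have mg k l : measurable_fun setT (g k l : g_sigma_algebraType gens -> R).
  apply: measurable_funM; first exact: measurable_indic.
  exact: measurable_funM.
have gb k l w : `|g k l w| <= q%:R.
  rewrite /g indicE; have [Qw|Qw] := pselect (Q w); last first.
    by rewrite memNset// mul0r normr0.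
  rewrite mem_set// mul1r; apply: (@le_trans _ _ (sqv (e w))) => //.
  have := coord_sq_le (e w) k; have := coord_sq_le (e w) l; rewrite normrM.
  rewrite -(real_normK (num_real (e w k 0))) -(real_normK (num_real (e w l 0))).
  by have := sqr_ge0 (`|e w k 0| - `|e w l 0|); nra.
have ig k l : integ P (fun w => g k l w * (A w k l - B w k l)).
  apply: integ_le (integZ q%:R (integ_norm (iAB k l))) _.
    by apply: measurable_funM; [exact: sub_measurable_fun (mg k l)|exact: integ_meas (iAB k l)].
  by apply: aeW => w; rewrite normrM ler_wpM2r.
have Eg k l : EX P (fun w => g k l w * (A w k l - B w k l)) = 0.
  by apply: (pull_out gm (iAB k l) (AB0 k l) (mg k l)); exact: ig.
have igs : integ P (fun w => \sum_k \sum_l g k l w * (A w k l - B w k l)).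
  by apply: integ_sum => k _; apply: integ_sum => l _; exact: ig.
have Es : EX P (fun w => \sum_k \sum_l g k l w * (A w k l - B w k l)) = 0.
  rewrite EX_sum => [|k _]; last by apply: integ_sum => l _; exact: ig.
  apply: big1 => k _; rewrite EX_sum => [|l _]; last exact: ig.
  by apply: big1 => l _; exact: Eg.
(* The zero on the left is replaced by the mean of the truncated form of A - B, which reduces the
   claim to the pointwise bound on B. *)
rewrite -Es; apply: EX_le => //; first exact: integ_restrict.
apply: filterS Bc => w /(_ (e w)) Bw.
have -> : \sum_k \sum_l g k l w * (A w k l - B w k l) =
    \1_Q w * (dotv (e w) (A w *m e w) - dotv (e w) (B w *m e w)).
  rewrite !dotv_mulmx_sum -sumrB mulr_sumr; apply: eq_bigr => k _.
  by rewrite -sumrB mulr_sumr; apply: eq_bigr => l _; rewrite /g; ring.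
by rewrite ler_wpM2l ?lerD2l ?lerN2// indicE; case: (w \in Q).
Qed.

End Truncation.

(** * Error, noise and excitation under the probabilistic hypotheses *)

Section Estimation.
Context {R : realType} {d : measure_display} {T : measurableType d}.
Variable P : probability T R.
Context (N M : nat) (m : 'I_N -> nat).
Variables (a : 'I_N -> 'I_N -> R) (x0 : 'I_N -> 'cV[R]_M).
Variables (alphai f : 'I_N -> nat -> R) (theta : 'cV[R]_M).
Variables (H : nat -> forall i : 'I_N, T -> 'M[R]_(m i, M)).
Variables (v : nat -> forall i : 'I_N, T -> 'cV[R]_(m i)).
Hypothesis ha_ge0 : forall i j, 0 <= a i j.
Hypothesis hf_ge0 : forall i t, 0 <= f i t.
Hypothesis hH_meas : forall t i, mxmeas (H t i).
Hypothesis hv_meas : forall t i, mxmeas (v t i).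
Hypothesis hindep : indep_sigma P (sigma_H H) (sigma_V v).
Variables (rho cV : R).
Hypothesis hrho : 2 < rho.
Hypothesis hmds : forall t i k,
  cond_exp_version P (filt_past H v t) (fun w => v t i w k 0) (fun _ => 0).
Hypothesis hmom : forall t, exists Y : T -> R,
  cond_exp_version_nonneg P (filt_past H v t)
    (fun w => enorm (stack (fun i => v t i w)) `^ rho) Y /\
  {ae P, forall w, Y w <= cV}.
Variable D : R.
Hypothesis hDH : {ae P, forall w, forall t, opnorm_sq_le (DH (fun i => H t i w)) D}.

Let Hw w s (j : 'I_N) : 'M[R]_(m j, M) := H s j w.
Let vw w s (j : 'I_N) : 'cV[R]_(m j) := v s j w.

Definition err t w := error a x0 alphai f theta (Hw w) (vw w) t.
Definition noise t w : 'cV[R]_(\sum_(i < N) m i) := stack (fun i => v t i w).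
Definition obs t w := DH (fun i => H t i w).
Definition G t w := gain a (Hw w) t.
Definition pull t w := trigger_pull a x0 alphai f theta (Hw w) (vw w) t.
Definition kick t w := noise_kick alphai (Hw w) (vw w) t.
Definition step_sizes t : 'M[R]_(\sum_(i < N) M) :=
  kron_id M (diag_mx (\row_i alphai i t)).
Definition mean_step t w := step_sizes t *m (- (G t w *m err t w) + pull t w).

Lemma step_sizes_stack t (u : 'I_N -> 'cV[R]_M) :
  step_sizes t *m stack u = stack (fun i => alphai i t *: u i).
Proof.
rewrite kron_id_stack; apply: eq_stack => i.
rewrite (bigD1 i)//= big1 ?addr0 => [|j ji].
  by rewrite !mxE eqxx mulr1n.
by rewrite !mxE eq_sym (negbTE ji) mulr0n scale0r.
Qed.

Lemma kickE t w : kick t w = step_sizes t *m (obs t w *m noise t w).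
Proof. by rewrite /obs /noise DH_stack step_sizes_stack. Qed.

Lemma mean_stepE t w :
  mean_step t w = stack (fun i => alphai i t *: drift a x0 alphai f theta (Hw w) (vw w) t i).
Proof. by rewrite -step_sizes_stack drift_stack. Qed.

Lemma err_step t w : err t.+1 w = err t w + mean_step t w + kick t w.
Proof. by rewrite mean_stepE; exact: error_step. Qed.

Section MeasurableFor.
Context {d' : measure_display} (T' : measurableType d') (toT : T' -> T) (t : nat).
Hypothesis mH : forall s i, (s < t)%N -> mxmeas (H s i \o toT).
Hypothesis mv : forall s i, (s < t)%N -> mxmeas (v s i \o toT).
Hypothesis mHt : forall i, mxmeas (H t i \o toT).

Let mstate i := mxmeas_state a x0 alphai f theta mH mv i.

(** Here and below [toT] is instantiated by the identity, [T'] being the same set with the ambient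
    or a generated sigma-algebra. The regressors at time t itself matter for the step, not for the
    error. *)
Lemma mxmeas_err : mxmeas (err t \o toT).
Proof.
apply: mxmeas_stack => i; apply: mxmeasB; last exact: mxmeas_cst.
exact: (mstate i).1.
Qed.

Lemma mxmeas_obs : mxmeas (obs t \o toT).
Proof.
apply: (@mxmeas_DH _ _ _ N M m (fun i => H t i \o toT)) => i.
exact: mHt.
Qed.

Lemma mxmeas_G : mxmeas (G t \o toT).
Proof.
apply: mxmeasD; first exact: mxmeas_cst.
by apply: mxmeas_mul; [|apply: mxmeas_tr]; exact: mxmeas_obs.
Qed.

Lemma mxmeas_pull : mxmeas (pull t \o toT).
Proof.
apply: mxmeas_mul; first exact: mxmeas_cst.
apply: mxmeas_stack => i; apply: mxmeasB; first exact: (mstate i).2.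
exact: (mstate i).1.
Qed.

Lemma mxmeas_mean_step : mxmeas (mean_step t \o toT).
Proof.
apply: mxmeas_mul; first exact: mxmeas_cst.
apply: mxmeasD; last exact: mxmeas_pull.
by apply: mxmeasN; apply: mxmeas_mul; [exact: mxmeas_G|exact: mxmeas_err].
Qed.

End MeasurableFor.

Lemma sqr_le_powR (x : R) : 0 <= x -> x ^+ 2 <= 1 + x `^ rho.
Proof.
move=> x0'; have [x1|x1] := lerP x 1.
  by apply: (@le_trans _ _ 1); [exact: exprn_ile1|rewrite lerDl powR_ge0].
rewrite -powR_mulrn// (@le_trans _ _ (x `^ rho))//; last by rewrite lerDr.
by rewrite ler_powR// ltW.
Qed.

Lemma filt_past_sub t : filt_past H v t `<=` measurable.
Proof.
apply: gen_sigma_sub => X [[s [i [k [l [_ ->]]]]]|[s [i [k [_ ->]]]]].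
  exact: hH_meas.
exact: hv_meas.
Qed.

(** The conditional moment bound is integrated over the whole space, and x^2 <= 1 + x^rho passes
    from the moment of order rho to the second one. *)
Lemma noise_L2 t : vL2 P (noise t) /\ EX P (fun w => sqv (noise t w)) <= 1 + `|cV|.
Proof.
have mn : mxmeas (noise t) by apply: mxmeas_stack.
have mpow : measurable_fun setT (fun w => enorm (noise t w) `^ rho).
  apply: (@measurableT_comp _ _ _ _ _ _ (@powR R ^~ rho)).
    exact: measurable_powR.
  exact: measurable_enorm.
have [Y [[Y0 [mY YE]] Yc]] := hmom t.
have FT : filt_past H v t setT.
  by rewrite /filt_past/gen_sigma; exact: (@measurableT _ (g_sigma_algebraType _)).
have mYT : measurable_fun setT Y by move=> _ B /mY; rewrite setTI; exact: filt_past_sub.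
have iY : integ P Y.
  apply: integ_le (integ_cst P cV) _ => //.
  by apply: filterS Yc => w; rewrite ger0_norm.
have ipow : integ P (fun w => enorm (noise t w) `^ rho).
  apply/integrableP; split; first exact/measurable_EFinP.
  under eq_integral do rewrite abse_EFin ger0_norm ?powR_ge0//.
  by rewrite -(YE _ FT) (EXE iY) ltry.
have Epow : EX P (fun w => enorm (noise t w) `^ rho) <= `|cV|.
  have : EX P (fun w => enorm (noise t w) `^ rho) = EX P Y by rewrite /EX -(YE _ FT).
  move=> ->; rewrite -[leRHS](EX_cst P); apply: EX_le => //; first exact: integ_cst.
  by apply: filterS Yc => w /le_trans; apply; exact: ler_norm.
have i1 := integD (integ_cst P 1) ipow.
have le1 w : sqv (noise t w) <= 1 + enorm (noise t w) `^ rho.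
  by rewrite -enorm_sq sqr_le_powR// sqrtr_ge0.
have nL2 : vL2 P (noise t) by apply: (vL2_le mn i1); exact: aeW.
split => //; apply: (@le_trans _ _ (EX P (fun w => 1 + enorm (noise t w) `^ rho))).
  by apply: EX_le; [exact: nL2.2|exact: i1|exact: aeW].
by rewrite (EXD (integ_cst P 1) ipow) EX_cst lerD2l.
Qed.

Lemma obs_bounded : {ae P, forall w, forall t x, sqv (obs t w *m x) <= `|D| * sqv x}.
Proof. by apply: filterS hDH => w hw t x; exact: opnorm_sq_leP (hw t). Qed.

Lemma obs_tr_bounded :
  {ae P, forall w, forall t x, sqv ((obs t w)^T *m x) <= `|D| * sqv x}.
Proof. by apply: filterS hDH => w hw t x; exact: opnorm_sq_le_tr (hw t). Qed.

Lemma G_bounded :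
  {ae P, forall w, forall t x, sqv (G t w *m x) <= gain_bound M a D * sqv x}.
Proof. by apply: filterS hDH => w hw t x; apply: gain_le; exact: hw. Qed.

Lemma pull_L2 t : vL2 P (pull t).
Proof.
apply: (@vL2_le _ _ _ _ _ _ (fun=> pull_bound M a * (\big[Num.max/0]_(j < N) f j t) ^+ 2)).
- by apply: (@mxmeas_pull _ _ id) => s i _; [exact: hH_meas|exact: hv_meas].
- exact: integ_cst.
- apply: aeW => w; apply: trigger_pull_le => // j.
  exact: le_bigmax.
Qed.

Lemma G_mul_L2 t (u : T -> 'cV_(\sum_(i < N) M)) : vL2 P u -> vL2 P (fun w => G t w *m u w).
Proof.
apply: (@vL2_mul _ _ _ _ _ _ (G t) (gain_bound M a D)).
  by apply: (@mxmeas_G _ _ id) => i; exact: hH_meas.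
by apply: filterS G_bounded => w; exact.
Qed.

Lemma kick_L2 t : vL2 P (kick t).
Proof.
have -> : kick t = fun w => step_sizes t *m (obs t w *m noise t w).
  by apply/funext => w; exact: kickE.
apply: vL2_mul_cst; apply: (@vL2_mul _ _ _ _ _ _ (obs t) `|D|).
- by apply: (@mxmeas_obs _ _ id) => i; exact: hH_meas.
- by apply: filterS obs_bounded => w; exact.
- exact: (noise_L2 t).1.
Qed.

Lemma err_mean_step_L2 t : vL2 P (err t) /\ vL2 P (mean_step t).
Proof.
have step s : vL2 P (err s) -> vL2 P (mean_step s).
  move=> es; apply: vL2_mul_cst; apply: vL2D; last exact: pull_L2.
  by apply: vL2N; exact: G_mul_L2.
elim: t => [|t [et mt]].
  suff e0 : vL2 P (err 0) by split => //; exact: step.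
  apply: (@vL2_le _ _ _ _ _ _ (fun=> sqv (stack (fun i => x0 i - theta)))).
  - exact: (mxmeas_cst (stack (fun i => x0 i - theta))).
  - exact: integ_cst.
  - exact: aeW.
suff e1 : vL2 P (err t.+1) by split => //; exact: step.
have -> : err t.+1 = fun w => err t w + mean_step t w + kick t w.
  by apply/funext => w; exact: err_step.
by apply: vL2D; [exact: vL2D|exact: kick_L2].
Qed.

Let pastV t : set (T -> R) :=
  [set X | exists s i k, (s < t)%N /\ X = fun w => v s i w k 0].
Let genH := preimages [set X | exists s i k l, X = fun w => H s i w k l].
Let genV := preimages [set X | exists s i k, X = fun w => v s i w k 0].
Let genpV t := preimages (pastV t).

(* The conditioning includes the whole sequence H, future values too. *)
Definition past t := rectangles genH (genpV t).

Lemma past_meas : (forall t, <<s past t >> `<=` measurable) /\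
  (forall t s i, mxmeas (H s i : g_sigma_algebraType (past t) -> _)) /\
  (forall t s i, (s < t)%N -> mxmeas (v s i : g_sigma_algebraType (past t) -> _)).
Proof.
split => [t|].
  apply: (@rectangles_meas _ _ genH genV (genpV t)).
  - by apply: gen_sigma_sub => _ [s [i [k [l ->]]]]; exact: hH_meas.
  - by apply: gen_sigma_sub => _ [s [i [k ->]]]; exact: hv_meas.
  - by apply: preimages_sub => _ [s [i [k [_ ->]]]]; exists s, i, k.
split => [t s i k l|t s i st k l].
  apply: (@measurable_preimages _ _ _ _ (fun w => H s i w k l) (past t) _
    (@sub_gens1_rectangles _ _ genH (genpV t))).
  by exists s, i, k, l.
apply: (@measurable_preimages _ _ _ _ (fun w => v s i w k l) (past t) _
  (@sub_gens2'_rectangles _ _ genH (genpV t))).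
by rewrite (ord1 l); exists s, i, k.
Qed.

Lemma noise_centred t k A : <<s past t >> A ->
  (\int[P]_(w in A) (noise t w k 0)%:E = 0)%E.
Proof.
pose i := tagnat.sig1 k; pose l := tagnat.sig2 k.
have -> : (fun w => (noise t w k 0)%:E) = (fun w => (v t i w l 0)%:E).
  by apply/funext => w; rewrite mxE.
have [iv [_ [_ v0]]] := hmds t l.
apply: (@integral_rectangles0 _ _ _ P genH genV (genpV t)) => //.
- by apply: gen_sigma_sub => _ [s [j [p [q ->]]]]; exact: hH_meas.
- by apply: gen_sigma_sub => _ [s [j [p ->]]]; exact: hv_meas.
- by apply: preimages_sub => _ [s [j [p [_ ->]]]]; exists s, j, p.
- apply: (@measurable_preimages _ _ _ _ (fun w => v t i w l 0) genV _ (fun A GA => GA)).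
  by exists t, i, l.
(* The martingale property is invoked only on events generated by the past of v; independence
   supplies all of H. *)
- move=> B GB; rewrite -v0; first by rewrite integral0.
  apply: (preimages_sub _ GB) => X [s [j [p [st ->]]]]; right.
  by exists s, j, p.
Qed.

(** Transposing step sizes and regressors onto Y leaves coefficients measurable for [past t], which
    contains H(t); each then multiplies a centred coordinate of the noise. *)
Lemma noise_orthogonal t (Y : T -> 'cV_(\sum_(i < N) M)) :
  mxmeas (Y : g_sigma_algebraType (past t) -> _) -> vL2 P Y ->
  EX P (fun w => dotv (Y w) (kick t w)) = 0.
Proof.
move=> mY Y2; have [pm [pH pv]] := past_meas.
pose g w := (obs t w)^T *m ((step_sizes t)^T *m Y w).
have -> : (fun w => dotv (Y w) (kick t w)) =
    (fun w => \sum_k g w k 0 * noise t w k 0).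
  by apply/funext => w; rewrite kickE !dotv_mulr.
have g2 : vL2 P g.
  apply: (@vL2_mul _ _ _ _ _ _ (fun w => (obs t w)^T) `|D|).
  - apply: mxmeas_tr; apply: (@mxmeas_obs _ _ id) => i; exact: hH_meas.
  - by apply: filterS obs_tr_bounded => w; exact.
  - exact: vL2_mul_cst.
have [n2 _] := noise_L2 t.
rewrite EX_sum => [|k _]; last exact: integ_coord_mul.
apply: big1 => k _; apply: (pull_out (pm t)).
- have -> : (fun w => noise t w k 0) =
      (fun w => v t (tagnat.sig1 k) w (tagnat.sig2 k) 0).
    by apply/funext => w; rewrite mxE.
  by case: (hmds t (tagnat.sig2 k)).
- by move=> A; exact: noise_centred.
- apply: (@mxmeas_mul _ _ (g_sigma_algebraType (past t)) _ _ _ (fun w => (obs t w)^T)).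
    apply: (@mxmeas_tr _ _ (g_sigma_algebraType (past t))).
    apply: (@mxmeas_obs _ (g_sigma_algebraType (past t)) id) => i; exact: pH.
  by apply: (@mxmeas_mul _ _ (g_sigma_algebraType (past t)) _ _ _ (fun=> (step_sizes t)^T)) => //.
- exact: integ_coord_mul.
Qed.

Let CG := gain_bound M a D.
Let CU := 4 * CG + 6 * pull_bound M a.
Let CV := `|D| * (1 + `|cV|).

(** One constant for all estimates below. The coefficients 4, 4 and 8 are those of [increment_le],
    the most demanding of them; the leading 1 comes from Young's inequality. *)
Definition step_const : R := 1 + 4 * CG + 4 * CU + 8 * CV.

Let CG0 : 0 <= CG. Proof. exact: gain_bound_ge0. Qed.
Let CU0 : 0 <= CU.
Proof. by rewrite addr_ge0// mulr_ge0// pull_bound_ge0. Qed.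
Let CV0 : 0 <= CV. Proof. by rewrite mulr_ge0// addr_ge0. Qed.

Lemma step_const_ge1 : 1 <= step_const.
Proof. by have := CG0; have := CU0; have := CV0; rewrite /step_const; lra. Qed.

Definition mse t := EX P (fun w => sqv (err t w)).

Lemma mse_ge0 t : 0 <= mse t.
Proof. by apply: EX_ge0 => w; exact: sqv_ge0. Qed.

Lemma quad_G_le t (u : T -> 'cV_(\sum_(i < N) M)) : vL2 P u ->
  `|EX P (fun w => dotv (u w) (G t w *m u w))| <=
  step_const * EX P (fun w => sqv (u w)).
Proof.
move=> u2; have Gu2 := G_mul_L2 t u2; have iq := integ_dotv u2 Gu2.
have b w : (forall t x, sqv (G t w *m x) <= CG * sqv x) ->
    `|dotv (u w) (G t w *m u w)| <= step_const * sqv (u w).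
  move=> /(_ t (u w)); have := dotv_le (u w) (G t w *m u w).
  have := sqv_ge0 (u w); have := CG0; have := CU0; have := CV0.
  by rewrite /step_const; nra.
have ic := integZ step_const u2.2.
rewrite ler_norml -(EXZ _ u2.2); apply/andP; split; last first.
  apply: EX_le => //; apply: filterS G_bounded => w /b.
  by apply: le_trans; exact: ler_norm.
rewrite lerNl -[leLHS]mulN1r -EXZ//; apply: EX_le => //; first exact: integZ.
apply: filterS G_bounded => w /b; apply: le_trans.
by rewrite mulN1r -normrN ler_norm.
Qed.

(** With u = err t - err s, the two cross terms are split by Young's inequality. The weight 1/eps
    falls on u, whose mean square is of order eps^2 within a block; the term purely in u is absorbed
    because 1/eps >= 1. *)
Lemma quad_base_change s t (eps : R) : 0 < eps -> eps <= 1 ->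
  EX P (fun w => dotv (err s w) (G t w *m err s w)) <=
  EX P (fun w => dotv (err t w) (G t w *m err t w)) +
  step_const * (eps * mse s + eps^-1 * EX P (fun w => sqv (err t w - err s w))).
Proof.
move=> eps0 eps1; have es := (err_mean_step_L2 s).1; have et := (err_mean_step_L2 t).1.
have [_ iD] : vL2 P (fun w => err t w - err s w) := vL2D et (vL2N es).
have iqs := integ_dotv es (G_mul_L2 t es); have iqt := integ_dotv et (G_mul_L2 t et).
have i1 := integD (integZ eps es.2) (integZ eps^-1 iD).
rewrite /mse -(EXZ _ es.2) -(EXZ _ iD) -(EXD (integZ eps es.2) (integZ eps^-1 iD)).
rewrite -(EXZ _ i1) -(EXD iqt (integZ step_const i1)).
apply: EX_le => //; first exact: (integD iqt (integZ step_const i1)).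
apply: filterS G_bounded => w /(_ t) Gb.
have {}Gb x : sqv (G t w *m x) <= CG * sqv x by exact: Gb.
have [u uE] : exists u, u = err t w - err s w by eexists.
have -> : err t w = err s w + u by rewrite uE addrC subrK.
rewrite [err s w + u - _]addrC addKr mulmxDr dotvDl !dotvDr.
have y1 := dotv_young (err s w) (- (G t w *m u)) eps0.
have y2 := dotv_young (G t w *m err s w) (- u) eps0.
have y3 := dotv_le u (G t w *m u).
have y4 : - dotv u (G t w *m u) <= `|dotv u (G t w *m u)| by rewrite -normrN ler_norm.
rewrite dotvNr !sqvN in y1; rewrite dotvNr !sqvN (dotvC _ u) in y2.
have ei0 : 0 <= eps^-1 by rewrite invr_ge0 ltW.
have b1 := ler_wpM2l (ltW eps0) (Gb (err s w)).
have b2 := ler_wpM2l ei0 (Gb u); have b3 := Gb u.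
have U0 := sqv_ge0 u; have S0 := sqv_ge0 (err s w).
have V1 : sqv u <= eps^-1 * sqv u by rewrite ler_peMl// invf_ge1.
have V2 : CG * sqv u <= eps^-1 * (CG * sqv u).
  by rewrite ler_peMl ?mulr_ge0// invf_ge1.
have W1 := mulr_ge0 (ltW eps0) S0; have W2 := mulr_ge0 ei0 U0.
have e1 := mulr_ge0 CG0 W1; have e2 := mulr_ge0 CG0 W2.
have e3 := mulr_ge0 CU0 W1; have e4 := mulr_ge0 CU0 W2.
have e5 := mulr_ge0 CV0 W1; have e6 := mulr_ge0 CV0 W2.
rewrite /step_const; lra.
Qed.

Lemma EX_kick_le t al : 0 < al -> (forall i, `|alphai i t| <= 2 * al) ->
  EX P (fun w => sqv (kick t w)) <= 4 * CV * al ^+ 2.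
Proof.
move=> al0 hal; have [n2 nb] := noise_L2 t; have := kick_L2 t => -[_ ik].
apply: (@le_trans _ _ (4 * `|D| * al ^+ 2 * EX P (fun w => sqv (noise t w)))).
  rewrite -EXZ ?n2.2//; apply: EX_le => //; first exact: integZ n2.2.
  apply: filterS hDH => w hw; apply: noise_kick_le => //; exact: hw.
have -> : 4 * CV * al ^+ 2 = 4 * `|D| * al ^+ 2 * (1 + `|cV|) by rewrite /CV; ring.
by rewrite ler_wpM2l// mulr_ge0 ?sqr_ge0// mulr_ge0.
Qed.

(** * One step, when all small quantities are below a common eps *)

Section OneStep.
Variables (t : nat) (al eps beta : R).
Hypotheses (al0 : 0 < al) (eps0 : 0 < eps) (eps1 : eps <= 1) (beta0 : 0 <= beta).
Hypotheses (al_eps : al <= eps) (al_beta : al <= eps * beta).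
Hypothesis hal : forall i, `|alphai i t / al - 1| <= eps.
Hypothesis hfe : forall j, f j t ^+ 2 <= eps ^+ 2 * beta.

Let pert w := perturbation a x0 alphai f theta (Hw w) (vw w) t al.

Let mean_stepK w : mean_step t w = al *: (- (G t w *m err t w) + pert w).
Proof.
have : err t.+1 w = err t w + al *: (- (G t w *m err t w) + pert w) + kick t w.
  exact: error_step_perturbation.
by rewrite err_step => /addIr/addrI.
Qed.

Let alphai_le i : `|alphai i t| <= 2 * al.
Proof.
have -> : alphai i t = al * (alphai i t / al - 1) + al.
  by rewrite mulrBr mulr1 mulrC divfK ?gt_eqF// subrK.
rewrite (le_trans (ler_normD _ _))// normrM (gtr0_norm al0).
have := hal i; rewrite -(ler_pM2l al0) => h1.
by have := ler_wpM2l (ltW al0) eps1; lra.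
Qed.

Let pert_le w : (forall t, opnorm_sq_le (obs t w) D) ->
  sqv (pert w) <= eps ^+ 2 * (CU * (sqv (err t w) + beta)).
Proof. move=> hw; apply: perturbation_le => //; exact: hw.
Qed.

Lemma mean_step_le w : (forall t, opnorm_sq_le (obs t w) D) ->
  sqv (mean_step t w) <= al ^+ 2 * (2 * CG * sqv (err t w) + 2 * CU * (sqv (err t w) + beta)).
Proof.
move=> hw; rewrite mean_stepK sqvZ ler_wpM2l ?sqr_ge0//.
apply: le_trans (sqvD_le _ _) _; rewrite sqvN -!mulrA lerD// ler_pM2l//.
  by apply: gain_le; exact: hw.
apply: le_trans (pert_le hw) _; rewrite ler_piMl ?exprn_ile1// ?(ltW eps0)//.
by rewrite mulr_ge0// addr_ge0// sqv_ge0.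
Qed.

(** Young's inequality with weight eps balances the error against a perturbation of squared size
    eps^2, costing 1 + CU. The square of the step costs 2 CG + 2 CU, since al^2 <= al eps. *)
Lemma err_mean_step_le w : (forall t, opnorm_sq_le (obs t w) D) ->
  sqv (err t w + mean_step t w) <= sqv (err t w)
    - 2 * al * dotv (err t w) (G t w *m err t w)
    + al * eps * (1 + 2 * CG + 3 * CU) * (sqv (err t w) + beta).
Proof.
move=> hw; have dm : dotv (err t w) (mean_step t w) =
    al * (- dotv (err t w) (G t w *m err t w) + dotv (err t w) (pert w)).
  by rewrite mean_stepK dotvZr dotvDr dotvNr.
rewrite sqvD dm; have := mean_step_le hw; have := pert_le hw.
have := dotv_young (err t w) (pert w) eps0.
set S := sqv (err t w); set U := sqv (pert w).
set q := dotv _ (G t w *m _); set p := dotv _ (pert w).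
have S0 : 0 <= S by exact: sqv_ge0.
move=> pU UC mC.
have UC' : eps^-1 * U <= eps * (CU * (S + beta)).
  by rewrite ler_pdivrMl// (le_trans UC)// expr2 -mulrA.
have al2 : al ^+ 2 <= al * eps by rewrite expr2 ler_pM2l.
have X0 : 0 <= 2 * CG * S + 2 * CU * (S + beta).
  by rewrite addr_ge0 ?mulr_ge0// addr_ge0.
have := ler_wpM2r X0 al2 => mC'.
have := ler_pM2l al0 (2 * p) (eps * S + eps * (CU * (S + beta))).
have pb : 2 * p <= eps * S + eps * (CU * (S + beta)) by lra.
rewrite pb => pb'.
have g1 : 0 <= al * eps * (1 + 2 * CG) * beta by rewrite !mulr_ge0 ?(ltW al0) ?(ltW eps0) ?addr_ge0 ?mulr_ge0.
lra.
Qed.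

(** The cross term with the noise has mean zero, and [al_beta] turns the noise variance, of order
    al^2, into al eps beta. *)
Lemma mse_step : mse t.+1 <=
  mse t - 2 * al * EX P (fun w => dotv (err t w) (G t w *m err t w)) +
  al * eps * step_const * (mse t + beta).
Proof.
have [e2 m2] := err_mean_step_L2 t; have k2 := kick_L2 t.
have em2 := vL2D e2 m2.
have iq := integ_dotv e2 (G_mul_L2 t e2).
have orth : EX P (fun w => dotv (err t w + mean_step t w) (kick t w)) = 0.
  apply: noise_orthogonal em2; have [_ [pH pv]] := past_meas.
  apply: mxmeasD.
    by apply: (@mxmeas_err _ (g_sigma_algebraType (past t)) id) => s i st; [exact: pH|exact: pv].
  apply: (@mxmeas_mean_step _ (g_sigma_algebraType (past t)) id) => [s i _|s i st|i].
  - exact: pH.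
  - exact: pv.
  - exact: pH.
have E : mse t.+1 = EX P (fun w => sqv (err t w + mean_step t w)) + EX P (fun w => sqv (kick t w)).
  rewrite /mse (_ : (fun w => sqv (err t.+1 w)) = fun w => (sqv (err t w + mean_step t w) +
     2 * dotv (err t w + mean_step t w) (kick t w)) + sqv (kick t w)); last first.
    by apply/funext => w; rewrite err_step sqvD.
  have i2 := integZ 2 (integ_dotv em2 k2).
  rewrite EXD ?(EXD em2.2 i2) ?EXZ ?orth ?mulr0 ?addr0//.
  - exact: integ_dotv.
  - exact: (integD em2.2 i2).
  - exact: k2.2.
have kb := EX_kick_le al0 alphai_le.
pose B w := sqv (err t w) - 2 * al * dotv (err t w) (G t w *m err t w) +
  al * eps * (1 + 2 * CG + 3 * CU) * (sqv (err t w) + beta).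
have iSb := integD e2.2 (integ_cst P beta).
have iB1 := integB e2.2 (integZ (2 * al) iq).
have iB2 := integZ (al * eps * (1 + 2 * CG + 3 * CU)) iSb.
have EB : EX P B = mse t - 2 * al * EX P (fun w => dotv (err t w) (G t w *m err t w)) +
    al * eps * (1 + 2 * CG + 3 * CU) * (mse t + beta).
  rewrite /B (EXD iB1 iB2) (EXB e2.2 (integZ (2 * al) iq)) !EXZ//.
  by rewrite (EXD e2.2 (integ_cst P beta)) EX_cst.
have le : EX P (fun w => sqv (err t w + mean_step t w)) <= EX P B.
  apply: EX_le; [exact: em2.2|exact: integD iB1 iB2|].
  by apply: filterS hDH => w hw; exact: err_mean_step_le.
rewrite E; apply: le_trans (lerD le kb) _; rewrite EB -!addrA lerD2l lerD2l.
have s0 := mse_ge0 t.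
have a1 : al ^+ 2 * CV <= al * eps * beta * CV.
  by rewrite ler_wpM2r// expr2 -mulrA ler_wpM2l// ltW.
have ae : 0 <= al * eps by rewrite mulr_ge0// ltW.
have sb := addr_ge0 s0 beta0; have asb := mulr_ge0 ae sb.
have g1 := mulr_ge0 asb CG0; have g2 := mulr_ge0 asb CU0.
have g3 := mulr_ge0 asb CV0; have g4 := mulr_ge0 (mulr_ge0 ae s0) CV0.
rewrite /step_const; lra.
Qed.

Lemma increment_le :
  EX P (fun w => sqv (err t.+1 w - err t w)) <= eps ^+ 2 * (step_const * (mse t + beta)).
Proof.
have [e2 m2] := err_mean_step_L2 t; have k2 := kick_L2 t; have mk2 := vL2D m2 k2.
rewrite (_ : (fun w => sqv (err t.+1 w - err t w)) = fun w => sqv (mean_step t w + kick t w)); last first.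
  by apply/funext => w; rewrite err_step -(addrA (err t w)) [err t w + _]addrC addrK.
have iSb := integD e2.2 (integ_cst P beta).
have i1 := integD (integZ (2 * CG) e2.2) (integZ (2 * CU) iSb).
have i2 := integD (integZ (2 * al ^+ 2) i1) (integZ 2 k2.2).
have le : EX P (fun w => sqv (mean_step t w + kick t w)) <= EX P (fun w =>
    2 * al ^+ 2 * (2 * CG * sqv (err t w) + 2 * CU * (sqv (err t w) + beta)) +
    2 * sqv (kick t w)).
  apply: EX_le => //; first exact: mk2.2.
  apply: filterS hDH => w hw; apply: le_trans (sqvD_le _ _) _.
  by rewrite lerD2r -mulrA ler_pM2l//; exact: mean_step_le.
apply: le_trans le _.
rewrite (EXD (integZ (2 * al ^+ 2) i1) (integZ 2 k2.2)) (EXZ _ i1) (EXZ _ k2.2).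
rewrite (EXD (integZ (2 * CG) e2.2) (integZ (2 * CU) iSb)) (EXZ _ e2.2) (EXZ _ iSb).
rewrite (EXD e2.2 (integ_cst P beta)) EX_cst -/(mse t).
have kb := EX_kick_le al0 alphai_le; have s0 := mse_ge0 t.
have a1 : al ^+ 2 <= eps ^+ 2 by rewrite ler_pXn2r ?nnegrE// ltW.
(* One factor al is bounded by eps, the other by eps beta; this puts the noise on the scale of
   beta. *)
have a2 : al ^+ 2 <= eps ^+ 2 * beta.
  by rewrite !expr2 -mulrA; apply: ler_pM => //; exact: ltW.
have X0 : 0 <= 2 * CG * mse t + 2 * CU * (mse t + beta).
  by rewrite addr_ge0 ?mulr_ge0// addr_ge0.
have := ler_wpM2r X0 a1 => h1; have := ler_wpM2r CV0 a2 => h2.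
have e20 := sqr_ge0 eps.
have g1 := mulr_ge0 e20 (mulr_ge0 CG0 beta0).
have g2 := mulr_ge0 e20 (mulr_ge0 CV0 s0).
have g3 := mulr_ge0 e20 (addr_ge0 s0 beta0).
have g4 := mulr_ge0 e20 (mulr_ge0 CU0 beta0).
rewrite /step_const; lra.
Qed.

End OneStep.

(** * Conditional excitation over a block *)

Variables (h : nat) (c : R).
Hypothesis hPE : forall mm : nat, exists Y : nat -> T -> 'M[R]_(\sum_(i < N) M),
  (forall t, (mm * h <= t < mm.+1 * h)%N ->
     cond_exp_version_mx P (filt_past H v (mm * h))
       (fun w => kron_id M (lapbar a) + DH (fun i => H t i w) *m (DH (fun i => H t i w))^T)
       (Y t)) /\
  (forall t w, (Y t w)^T = Y t w) /\
  {ae P, forall w, lambda_min_ge (\sum_(mm * h <= t < mm.+1 * h) Y t w) c}.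

(** The error at the block start is generated by the data before it, so the sum of the forms can be
    compared with that of the conditional expectations, where the eigenvalue bound applies. *)
Lemma excitation mm (s := (mm * h)%N) :
  c * EX P (fun w => sqv (err s w)) <=
  \sum_(s <= t < mm.+1 * h) EX P (fun w => dotv (err s w) (G t w *m err s w)).
Proof.
have [Y [YX [Ysym Yc]]] := hPE mm.
pose X t w := kron_id M (lapbar a) + obs t w *m (obs t w)^T.
have XG t w e : dotv e (G t w *m e) = dotv e (X t w *m e).
  by rewrite /G /gain /X !mulmxDl !dotvDr dotv_kron_lapbar.
have e2 := (err_mean_step_L2 s).1.
have iXe t : integ P (fun w => dotv (err s w) (G t w *m err s w)).
  by apply: integ_dotv => //; exact: G_mul_L2.
rewrite -EX_sum//.
have Esum w : \sum_(s <= t < mm.+1 * h) dotv (err s w) (G t w *m err s w) =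
    dotv (err s w) ((\sum_(s <= t < mm.+1 * h) X t w) *m err s w).
  rewrite mulmx_suml; under eq_bigr do rewrite XG.
  rewrite /dotv exchange_big/=; apply: eq_bigr => k _.
  by rewrite summxE mulr_sumr.
rewrite [Z in _ <= EX P Z](_ : _ = fun w =>
    dotv (err s w) ((\sum_(s <= t < mm.+1 * h) X t w) *m err s w)); last first.
  by apply/funext => w; exact: Esum.
have iX t k l : (s <= t < mm.+1 * h)%N -> integ P (fun w => X t w k l).
  by move=> /YX/(_ k l)[].
have iY t k l : (s <= t < mm.+1 * h)%N -> integ P (fun w => Y t w k l).
  by move=> /YX/(_ k l)[_ []].
(* The range is repeated as a filter, because the rules for sums hand on only the filter to the
   individual terms. *)
have EAB k l : (fun w => (\sum_(s <= t < mm.+1 * h) X t w) k l -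
    (\sum_(s <= t < mm.+1 * h) Y t w) k l) =
    fun w => \sum_(s <= t < mm.+1 * h | (s <= t < mm.+1 * h)%N) (X t w k l - Y t w k l).
  by apply/funext => w; rewrite -big_nat !summxE sumrB.
pose gens := preimages [set X : T -> R |
  (exists r i k l, (r < s)%N /\ X = fun w => H r i w k l) \/
  (exists r i k, (r < s)%N /\ X = fun w => v r i w k 0)].
have iXY t k l : (s <= t < mm.+1 * h)%N -> integ P (fun w => X t w k l - Y t w k l).
  by move=> st; apply: integB; [exact: iX|exact: iY].
apply: (conditional_quad_ge (gens := gens)
  (B := fun w => \sum_(s <= t < mm.+1 * h) Y t w)).
- exact: filt_past_sub.
- by move=> k l; rewrite EAB; apply: integ_sum => t st; exact: iXY.
- move=> k l S GS; have mS : measurable S by exact: (@filt_past_sub s).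
  have -> : (fun w => ((\sum_(s <= t < mm.+1 * h) X t w) k l -
    (\sum_(s <= t < mm.+1 * h) Y t w) k l)%:E) = (fun w => (\sum_(s <= t < mm.+1 * h | (s <= t < mm.+1 * h)%N) (X t w k l - Y t w k l))%:E).
    by apply/funext => w; rewrite -(congr1 (@^~ w) (EAB k l)).
  rewrite integral_restrictE//; last by apply: integ_sum => t st; exact: iXY.
  under [X in EX P X]eq_fun do rewrite mulr_sumr.
  rewrite EX_sum => [|t st]; last by apply: integ_restrict => //; exact: iXY.
  rewrite big1// => t st.
  have [_ [_ [_ /(_ S GS)]]] := YX t st k l.
  have i1 := integ_restrict mS (iX t k l st); have i2 := integ_restrict mS (iY t k l st).
  rewrite !integral_restrictE//; [|exact: iX|exact: iY].
  under [X in EX P X = _]eq_fun do rewrite mulrBr.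
  by rewrite EXB// => -[->]; rewrite subrr.
- have pg : <<s gens >> `<=` <<s gens >> by [].
  apply: (@mxmeas_err _ (g_sigma_algebraType gens) id) => r i rs k l; last first.
    rewrite (ord1 l); apply: (measurable_preimages (X := fun w => v r i w k 0) _ pg).
    by right; exists r, i, k.
  apply: (measurable_preimages (X := fun w => H r i w k l) _ pg).
  by left; exists r, i, k, l.
- exact: e2.2.
- have -> : (fun w => dotv (err s w) ((\sum_(s <= t < mm.+1 * h) X t w) *m err s w)) =
      fun w => \sum_(s <= t < mm.+1 * h) dotv (err s w) (G t w *m err s w).
    by apply/funext => w; rewrite Esum.
  by apply: integ_sum => t _; exact: iXe.
- apply: filterS Yc => w Yw x; apply: lambda_min_quad => //.
  by rewrite linear_sum; apply: eq_bigr => t _; exact: Ysym.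
Qed.


End Estimation.

(** * Recursion over one block *)

Section BlockRecursion.
Context {R : realType}.

Lemma block_recursion (K C1 C2 : R) (h : nat) : 1 <= K -> 0 <= C1 -> 0 <= C2 ->
  exists2 C : R, 1 <= C & forall (al be s q q0 dl : nat -> R) (eps : R),
  0 < eps -> eps <= 1 -> 0 < al 0%N -> 0 <= be 0%N -> (forall j, 0 <= s j) ->
  dl 0%N = 0 ->
  (forall j, (j < h)%N -> [/\ 0 < al j <= eps, be j <= C2 * be 0%N,
     `|al j - al 0%N| <= C1 * eps * al 0%N & 0 <= be j]) ->
  (forall j, (j < h)%N -> [/\ s j.+1 <= s j - 2 * al j * q j + al j * eps * K * (s j + be j),
     `|q j| <= K * s j, dl j.+1 <= 2 * dl j + 2 * (eps ^+ 2 * (K * (s j + be j))) &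
     q0 j <= q j + K * (eps * s 0%N + eps^-1 * dl j)]) ->
  [/\ s h <= C * (s 0%N + eps * be 0%N), dl h <= C * eps ^+ 2 * (s 0%N + be 0%N) &
   s h <= s 0%N - 2 * al 0%N * (\sum_(j < h) q0 j) + C * eps * al 0%N * (s 0%N + be 0%N)].
Proof.
move=> K1 C10 C20; elim: h => [|h [C C_1 IH]].
  exists 1 => // al be s q q0 dl eps e0 e1 al0 be0 s0 dl0 _ _.
  have ? := s0 0%N; have eb : 0 <= eps * be 0%N by rewrite mulr_ge0// ltW.
  rewrite big_ord0 dl0 mulr0 subr0 !mul1r; split; first by rewrite lerDl.
    by rewrite mulr_ge0 ?sqr_ge0// addr_ge0.
  by rewrite lerDl; apply: mulr_ge0 (addr_ge0 _ be0) => //; apply: mulr_ge0; exact: ltW.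
(* The old constant, followed by what one more step adds to each of the three conclusions. *)
exists (C + (3 * K * C + K * C2) + (C + 2 * (K * C + K * C2)) +
    (2 * C1 * K * C + 2 * K * (1 + C) + (1 + C1) * K * (C + C2))).
  have p1 : 0 <= K * C by apply: mulr_ge0; lra.
  have p2 : 0 <= K * C2 by apply: mulr_ge0; lra.
  have p3 : 0 <= C1 * (K * C) by apply: mulr_ge0; lra.
  have p4 : 0 <= C1 * (K * C2) by apply: mulr_ge0; lra.
  lra.
move=> al be s q q0 dl eps e0 e1 al0 be0 s0 dl0 Hal Hs.
have [Sa Sb Sc] := IH al be s q q0 dl eps e0 e1 al0 be0 s0 dl0
  (fun j jh => Hal j (ltnW jh)) (fun j jh => Hs j (ltnW jh)).
have [/andP[alh alh1] beh alC bh0] := Hal h (ltnSn h).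
have [S1 S2 S3 S4] := Hs h (ltnSn h).
have s00 := s0 0%N; have sh0 := s0 h.
set S := s 0%N in Sa Sb Sc S4 *; set B := be 0%N in Sa Sb Sc beh be0 *.
set A := al 0%N in Sc al0 alC *.
have [qa qb] : - (K * s h) <= q h /\ q h <= K * s h by move: S2; rewrite ler_norml => /andP[].
have SB : 0 <= S + B by rewrite addr_ge0.
have eSB : s h <= C * (S + B).
  apply: le_trans Sa _; rewrite ler_wpM2l ?lerD2l ?ler_piMl//; lra.
have K0 : 0 <= K by lra.
have C0 : 0 <= C by lra.
have p1 : 0 <= K * C by apply: mulr_ge0.
have p2 : 0 <= K * C2 by apply: mulr_ge0.
have p3 : 0 <= C1 * (K * C) by apply: mulr_ge0.
have p4 : 0 <= C1 * (K * C2) by apply: mulr_ge0.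
have e2 : 0 <= eps ^+ 2 by rewrite sqr_ge0.
have eA : 0 <= eps * A by rewrite mulr_ge0// ltW.
have eB : 0 <= eps * B by rewrite mulr_ge0// ltW.
have KSB : K * (s h + be h) <= (K * C + K * C2) * (S + B).
  rewrite -mulrDr -mulrA ler_wpM2l// mulrDl lerD//.
  by apply: le_trans beh _; rewrite ler_wpM2l// lerDr.
split.
- have t1 : al h * q h >= - (1 * (K * s h)).
    have [q0'|q0'] := lerP 0 (q h).
      apply: (@le_trans _ _ 0); last by rewrite mulr_ge0// ltW.
      by rewrite oppr_le0 mul1r mulr_ge0.
    have : (1 - al h) * q h <= 0 by rewrite nmulr_lle0//; lra.
    lra.
  have t2 : al h * eps * K * (s h + be h) <= K * s h + eps * (K * (C2 * B)).
    rewrite mulrDr; apply: lerD.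
      rewrite -[leLHS]mulrA; apply: ler_piMl; first by rewrite mulr_ge0.
      by rewrite mulr_ile1 ?(ltW alh) ?(ltW e0)//; lra.
    have -> : al h * eps * K * be h = al h * (eps * (K * be h)) by ring.
    apply: (@le_trans _ _ (eps * (K * be h))).
      by apply: ler_piMl; [rewrite !mulr_ge0// ltW|lra].
    by rewrite ler_wpM2l ?(ltW e0)// ler_wpM2l.
  have u1 : s h.+1 <= s h + 2 * (K * s h) + (K * s h + eps * (K * (C2 * B))) by lra.
  have t3 := ler_wpM2l K0 Sa.
  have t4 : eps * (K * (C2 * B)) <= K * C2 * (S + eps * B).
    by rewrite mulrDr; have := mulr_ge0 p2 s00; rewrite -/S; lra.
  have W0 := addr_ge0 s00 eB; rewrite -/S in W0.
  move: (S + eps * B) W0 Sa t3 t4 => W W0 Sa t3 t4.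
  have g1 := mulr_ge0 p1 W0; have g3 := mulr_ge0 p2 W0.
  have g5 := mulr_ge0 p3 W0; have g7 := mulr_ge0 p4 W0.
  have g9 := mulr_ge0 C0 W0; have g11 := mulr_ge0 K0 W0.
  apply: (le_trans u1); lra.
- have t1 := ler_wpM2l e2 KSB.
  have f := mulr_ge0 e2 SB.
  have g1 := mulr_ge0 p1 f; have g2 := mulr_ge0 p2 f; have g3 := mulr_ge0 p3 f.
  have g4 := mulr_ge0 p4 f; have g5 := mulr_ge0 C0 f; have g6 := mulr_ge0 K0 f.
  lra.
- rewrite big_ord_recr/=.
  have alA : al h <= (1 + C1) * A.
    have : al h - A <= C1 * eps * A by apply: le_trans alC; exact: ler_norm.
    have : C1 * eps * A <= C1 * A.
      by rewrite ler_wpM2r ?(ltW al0)// ler_piMr.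
    lra.
  have t1 : al h * eps * K * (s h + be h) <= (1 + C1) * A * eps * ((K * C + K * C2) * (S + B)).
    rewrite -[leLHS]mulrA; apply: ler_pM => //.
    + by rewrite mulr_ge0// ltW.
    + by rewrite mulr_ge0// addr_ge0.
    + by rewrite ler_wpM2r// ltW.
  have t2 : - (2 * (al h - A) * q h) <= 2 * (C1 * eps * A * (K * (C * (S + B)))).
    rewrite -mulrA -mulrN ler_pM2l// (le_trans (ler_norm _))// normrN normrM.
    apply: ler_pM => //; apply: le_trans S2 _.
    by rewrite ler_wpM2l.
  (* The distance bound is of order eps^2, so division by eps still leaves eps. *)
  have t3 : A * q0 h <= A * q h + A * (K * (eps * S + eps * (C * (S + B)))).
    rewrite -mulrDr ler_pM2l//; apply: le_trans S4 _.
    rewrite lerD2l ler_wpM2l// lerD2l ler_pdivrMl//.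
    by apply: le_trans Sb _; rewrite expr2; lra.
  have f := mulr_ge0 eA SB.
  have g1 := mulr_ge0 p1 f; have g2 := mulr_ge0 p2 f; have g3 := mulr_ge0 p3 f.
  have g4 := mulr_ge0 p4 f; have g5 := mulr_ge0 C0 f; have g6 := mulr_ge0 K0 f.
  have g7 := mulr_ge0 K0 (mulr_ge0 eA be0).
  lra.
Qed.

End BlockRecursion.

(** * Step sizes and contraction *)

Section RealPowers.
Context {R : realType}.

(** Concavity of the logarithm between 1 and 1 + x, with weight p on the latter. *)
Lemma powR_bernoulli (x p : R) : 0 <= x -> 0 <= p -> p <= 1 ->
  (1 + x) `^ p <= 1 + p * x.
Proof.
move=> x0 p0 p1; have x1 : 0 < 1 + x by rewrite ltr_wpDr.
have px1 : 0 < 1 + p * x by rewrite ltr_wpDr// mulr_ge0.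
have := @concave_ln R (Itv01 p0 p1) (1 + x) 1 x1 ltr01.
rewrite !convRE/= ln1 mulr0 addr0 => pln.
rewrite /powR gt_eqF// -[leRHS]lnK ?posrE// ler_expR (le_trans pln)//.
rewrite le_eqVlt; apply/orP; left; apply/eqP; congr ln; rewrite /onem; ring.
Qed.

Lemma powR_le_scale (x y c p : R) : 0 <= x -> 0 <= y -> 1 <= c -> 0 <= p -> p <= 1 ->
  x <= c * y -> x `^ p <= c * y `^ p.
Proof.
move=> x0 y0 c1 p0 p1 xy; have c0 : 0 <= c by exact: le_trans c1.
apply: (@le_trans _ _ ((c * y) `^ p)).
  by apply: ge0_ler_powR; rewrite ?nnegrE// mulr_ge0.
rewrite powRM// ler_wpM2r ?powR_ge0//.
by rewrite -[leRHS]powRr1// ler_powR.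
Qed.

End RealPowers.

Section Contraction.
Context {R : realType}.

(** While lam Z exceeds 2 kappa, each step lowers Z by at least kappa al, which divergence cannot
    sustain. Once below that level, Z stays there, the next value being bounded through a convex
    combination. *)
Lemma contraction_small (Z al : nat -> R) (lam kappa : R) m0 :
  0 < lam -> 0 < kappa -> (forall m, 0 < al m) ->
  (forall m, (m0 <= m)%N -> lam * al m <= 1) ->
  (forall m, (m0 <= m)%N -> Z m.+1 <= (1 - lam * al m) * Z m + kappa * al m) ->
  (forall B, exists n, B <= \sum_(m0 <= m < n) al m) ->
  exists2 m1, (m0 <= m1)%N & forall m, (m1 <= m)%N -> lam * Z m <= 2 * kappa.
Proof.
move=> lam0 k0 al0 al1 rec div.
have [m1 m01 m1P] : exists2 m1, (m0 <= m1)%N & lam * Z m1 <= 2 * kappa.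
  apply: contrapT => nex.
  have big m : (m0 <= m)%N -> 2 * kappa < lam * Z m.
    by move=> mm; rewrite ltNge; apply/negP => mk; apply: nex; exists m.
  have dec n : (m0 <= n)%N -> Z n <= Z m0 - kappa * \sum_(m0 <= m < n) al m.
    elim: n => [|n IH]; first by rewrite leqn0 => /eqP ->; rewrite big_geq// mulr0 subr0.
    rewrite leq_eqVlt => /predU1P[<-|]; first by rewrite big_geq// mulr0 subr0.
    rewrite ltnS => mn; rewrite big_nat_recr//= mulrDr.
    have := IH mn; have := rec n mn; have := ltW (big n mn) => b r i.
    have := ler_wpM2l (ltW (al0 n)) b; lra.
  (* Enough total step to force Z down to -1, although Z is positive as long as the level is not
     reached. *)
  have [n nB] := div ((Z m0 + 1) / kappa).
  have nn : (m0 <= maxn m0 n)%N by rewrite leq_maxl.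
  have s_le : \sum_(m0 <= m < n) al m <= \sum_(m0 <= m < maxn m0 n) al m.
    have [nm|mn] := leqP n m0.
      by rewrite big_geq// sumr_ge0// => i _; exact: ltW.
    by [].
  have := dec _ nn; have := big _ nn.
  have := le_trans nB s_le; rewrite ler_pdivrMr// => h1 h2 h3.
  have : 0 < lam * Z (maxn m0 n) by lra.
  by rewrite pmulr_rgt0//; lra.
exists m1 => // m; elim: m => [|m IH].
  by rewrite leqn0 => /eqP m10; move: m1P; rewrite m10.
rewrite leq_eqVlt => /predU1P[<- //|]; rewrite ltnS => mm.
have mm0 := leq_trans m01 mm.
have := ler_wpM2l (ltW lam0) (rec m mm0).
have a1 := al1 m mm0; have a0 := al0 m.
have : (1 - lam * al m) * (lam * Z m) <= (1 - lam * al m) * (2 * kappa).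
  by rewrite ler_wpM2l ?subr_ge0// IH.
have : 0 <= kappa * (lam * al m) by rewrite !mulr_ge0// ltW.
lra.
Qed.

End Contraction.

(** * Variation of the step sizes within a block *)

Section StepSizes.
Context {R : realType}.
Variables (al : nat -> R) (alpha0 p : R) (h : nat).
Hypotheses (al0 : forall t, 0 < al t) (alpha0_ge0 : 0 <= alpha0).
Hypotheses (p0 : 0 <= p) (p1 : p <= 1).

(** Bounds the change of 1/alpha over h steps, each increment being at most alpha0 + eps with eps <=
    1. *)
Definition ratio_const : R := h%:R * (alpha0 + 1).

Lemma ratio_const_ge0 : 0 <= ratio_const.
Proof. by rewrite mulr_ge0// addr_ge0. Qed.

Variables (eps : R) (T : nat).
Hypotheses (eps0 : 0 < eps) (eps1 : eps <= 1).
Hypothesis al_eps : forall t, (T <= t)%N -> al t <= eps.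
Hypothesis al_inv : forall t, (T <= t)%N -> `|(al t.+1)^-1 - (al t)^-1 - alpha0| <= eps.

Lemma inv_diff j : `|(al (T + j))^-1 - (al T)^-1 - j%:R * alpha0| <= j%:R * eps.
Proof.
elim: j => [|j IH]; first by rewrite addn0 subrr !mul0r subr0 normr0.
have := al_inv (leq_addr j T); rewrite addnS.
have -> : (al (T + j).+1)^-1 - (al T)^-1 - j.+1%:R * alpha0 =
  ((al (T + j).+1)^-1 - (al (T + j))^-1 - alpha0) +
  ((al (T + j))^-1 - (al T)^-1 - j%:R * alpha0) by rewrite -natr1; ring.
move=> h1; apply: le_trans (ler_normD _ _) _.
by rewrite -natr1 mulrDl mul1r addrC lerD.
Qed.

Lemma inv_bounds j : (j <= h)%N ->
  - (h%:R * eps) <= (al (T + j))^-1 - (al T)^-1 <= h%:R * (alpha0 + eps).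
Proof.
move=> jh; have := inv_diff j; rewrite ler_norml => /andP[l u].
have jh' : j%:R <= h%:R :> R by rewrite ler_nat.
have := ler_wpM2r (ltW eps0) jh'; have := ler_wpM2r alpha0_ge0 jh'.
have := mulr_ge0 (ler0n R j) alpha0_ge0.
by move=> *; apply/andP; split; lra.
Qed.

Let alE j : al T - al (T + j) = ((al (T + j))^-1 - (al T)^-1) * al (T + j) * al T.
Proof. by field; rewrite !gt_eqF. Qed.

(** The difference of two steps is their product times the difference of their inverses; one of the
    two factors supplies eps. *)
Lemma al_dist j : (j <= h)%N -> `|al (T + j) - al T| <= ratio_const * eps * al T.
Proof.
move=> jh; have /andP[l u] := inv_bounds jh.
rewrite distrC alE normrM (gtr0_norm (al0 T)) ler_wpM2r ?(ltW (al0 T))//.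
rewrite normrM (gtr0_norm (al0 _)); apply: ler_pM => //; first exact: ltW.
  have he : h%:R * eps <= h%:R :> R by rewrite ler_piMr.
  have ha : 0 <= h%:R * alpha0 by rewrite mulr_ge0.
  by rewrite ler_norml /ratio_const; apply/andP; split; lra.
exact/al_eps/leq_addr.
Qed.

Lemma al_le j : (j <= h)%N -> al (T + j) <= (1 + ratio_const) * al T.
Proof.
move=> jh; have := le_trans (ler_norm _) (al_dist jh).
have : ratio_const * eps * al T <= ratio_const * al T.
  by rewrite ler_wpM2r ?(ltW (al0 T))// ler_piMr// ratio_const_ge0.
lra.
Qed.

Lemma al_ge j : (j <= h)%N -> al T <= (1 + ratio_const) * al (T + j).
Proof.
move=> jh; have /andP[l u] := inv_bounds jh.
have E := alE j; have a0 := al0 (T + j); have aT : al T <= 1 by exact: le_trans (al_eps (leqnn T)) eps1.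
have u' : (al (T + j))^-1 - (al T)^-1 <= ratio_const.
  by apply: le_trans u _; rewrite /ratio_const ler_wpM2l// lerD2l.
have := ler_wpM2r (ltW (al0 T)) (ler_wpM2r (ltW a0) u').
have : ratio_const * al (T + j) * al T <= ratio_const * al (T + j).
  by rewrite ler_piMr// mulr_ge0 ?ratio_const_ge0// ltW.
lra.
Qed.

Lemma al_pow_le j : (j <= h)%N -> al (T + j) `^ p <= (1 + ratio_const) * al T `^ p.
Proof.
move=> jh; apply: powR_le_scale => //; [exact: ltW|exact: ltW| |exact: al_le].
by rewrite lerDl ratio_const_ge0.
Qed.

Lemma al_pow_ge j : (j <= h)%N -> al T `^ p <= (1 + ratio_const) * al (T + j) `^ p.
Proof.
move=> jh; apply: powR_le_scale => //; [exact: ltW|exact: ltW| |exact: al_ge].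
by rewrite lerDl ratio_const_ge0.
Qed.

(** Unlike [al_pow_ge], this keeps the exact first-order coefficient p h alpha0, which must match
    the surplus in the excitation bound; Bernoulli's inequality provides the factor p. *)
Lemma al_pow_sharp :
  al T `^ p <= (1 + p * (h%:R * (alpha0 + eps) * al T)) * al (T + h) `^ p.
Proof.
have /andP[_ u] := inv_bounds (leqnn h).
have x0 : 0 <= h%:R * (alpha0 + eps) * al T.
  by rewrite mulr_ge0 ?(ltW (al0 T))// mulr_ge0// addr_ge0// ltW.
apply: le_trans (ler_wpM2r (powR_ge0 _ _) (powR_bernoulli x0 p0 p1)).
rewrite -powRM ?addr_ge0 ?(ltW (al0 _))//.
apply: ge0_ler_powR; rewrite ?nnegrE ?mulr_ge0 ?addr_ge0 ?(ltW (al0 _))//.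
have := ler_wpM2r (ltW (al0 T)) (ler_wpM2r (ltW (al0 (T + h))) u).
by have := alE h; lra.
Qed.

End StepSizes.

(** * Passing to the ratio s/b and to the step sizes at block starts *)

Section Normalisation.
Context {R : realType}.

Lemma normalised_step (al eps s s' b b' lam alpha0 delta C : R) (h : nat) :
  0 < al -> al <= eps -> eps <= 1 -> 0 <= s -> 0 <= s' -> 0 < b -> 0 < b' ->
  0 < lam -> 0 <= alpha0 -> 0 <= delta -> 0 <= C ->
  s' <= s - 2 * al * ((lam + h%:R * alpha0 * delta) * s) + C * eps * al * (s + b) ->
  b <= (1 + 2 * delta * (h%:R * (alpha0 + eps) * al)) * b' ->
  s' / b' <= (1 - 2 * lam * al +
    (C + 2 * delta * h%:R + (2 * (lam + h%:R * alpha0 * delta) + C + C) *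
       (2 * delta * (h%:R * (alpha0 + 1))) + C) * eps * al) * (s / b) +
    (C + 2 * delta * h%:R + (2 * (lam + h%:R * alpha0 * delta) + C + C) *
       (2 * delta * (h%:R * (alpha0 + 1))) + C) * eps * al.
Proof.
move=> al0 ale e1 s0 s'0 b0 b'0 lam0 a0 d0 C0 hs hb.
have e0 : 0 < eps by exact: lt_le_trans ale.
set c := lam + h%:R * alpha0 * delta in hs *.
set Y := 2 * delta * (h%:R * (alpha0 + 1)).
set y := 2 * delta * (h%:R * (alpha0 + eps)).
have h0 : 0 <= h%:R :> R by [].
have dh : 0 <= delta * h%:R by rewrite mulr_ge0.
have y0 : 0 <= y by rewrite !mulr_ge0// addr_ge0// ltW.
have yY : y <= Y.
  by rewrite /y /Y ler_wpM2l ?mulr_ge0// ler_wpM2l// lerD2l.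
have c0 : 0 <= c by rewrite addr_ge0 ?(ltW lam0)// !mulr_ge0.
set z := s / b; have z0 : 0 <= z by rewrite divr_ge0// ltW.
have sz : s = z * b by rewrite /z divfK// gt_eqF.
set br := (1 - 2 * al * c + C * eps * al) * z + C * eps * al.
have s'br : s' <= br * b by apply: le_trans hs _; rewrite /br sz; lra.
(* Nonnegativity of s' gives the sign of the factor, with no smallness of al involved; it is needed
   to multiply the bound on b. *)
have br0 : 0 <= br by rewrite -(pmulr_lge0 _ b0); exact: le_trans s'br.
have : s' / b' <= (1 + y * al) * br.
  rewrite ler_pdivrMr//; apply: le_trans s'br _.
  have -> : (1 + y * al) * br * b' = br * ((1 + y * al) * b') by ring.
  apply: ler_wpM2l => //; apply: le_trans hb _.
  by rewrite /y mulrA.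
move/le_trans; apply.
have ae0 : 0 <= eps * al by rewrite mulr_ge0// ltW.
have zae : 0 <= z * (eps * al) by rewrite mulr_ge0.
have al2 : al ^+ 2 <= eps * al by rewrite expr2 ler_wpM2r// ltW.
have t1 : y * al ^+ 2 <= Y * (eps * al) by apply: ler_pM => //; exact: sqr_ge0.
have ya0 : 0 <= y * al ^+ 2 := mulr_ge0 y0 (sqr_ge0 al).
have Y0 : 0 <= Y := le_trans y0 yY; have Yea0 := mulr_ge0 Y0 ae0.
have t2 : (C * eps) * (y * al ^+ 2) <= C * (Y * (eps * al)).
  apply: ler_pM => //; first by rewrite mulr_ge0// ltW.
  by rewrite ler_piMr.
have t3 := ler_wpM2r z0 t2.
have t4 := mulr_ge0 (mulr_ge0 c0 ya0) z0; have t5 := mulr_ge0 (mulr_ge0 c0 Yea0) z0.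
have t6 := mulr_ge0 c0 Yea0; have t7 := mulr_ge0 (mulr_ge0 C0 ae0) z0.
have t8 := mulr_ge0 C0 ae0; have t9 := mulr_ge0 (mulr_ge0 C0 Yea0) z0.
have t10 := mulr_ge0 C0 Yea0; have t11 := mulr_ge0 dh ae0.
have t12 : c = lam + h%:R * alpha0 * delta by [].
(* The cancellation: alpha0 disappears and only a multiple of eps remains beside -2 lam. *)
have t13 : (- 2 * c + y) * (al * z) =
   (- 2 * lam + 2 * delta * h%:R * eps) * (al * z) by rewrite /c /y; ring.
rewrite /br.
have -> : (1 + y * al) * ((1 - 2 * al * c + C * eps * al) * z + C * eps * al) =
  z + (- 2 * c + y) * (al * z) - 2 * (c * (y * al ^+ 2) * z) + C * (eps * al) * z +
  C * eps * (y * al ^+ 2) * z + C * (eps * al) + C * eps * (y * al ^+ 2) by ring.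
rewrite t13; lra.
Qed.

(** Each block sums to at most h C times its first step size, so convergence along block starts
    would bound the full sum. *)
Lemma block_sum_diverges (al : nat -> R) (h m0 : nat) (C : R) : 0 < C -> (0 < h)%N ->
  (forall t, 0 < al t) ->
  (forall m j, (m0 <= m)%N -> (j < h)%N -> al (m * h + j)%N <= C * al (m * h)%N) ->
  (forall B, exists n, B <= \sum_(k < n) al k) ->
  forall B, exists n, B <= \sum_(m0 <= m < n) al (m * h)%N.
Proof.
move=> C0 h0 al0 alC div B.
have bound n : (m0 <= n)%N -> \sum_(0 <= k < n * h) al k <=
    \sum_(0 <= k < m0 * h) al k + h%:R * C * \sum_(m0 <= m < n) al (m * h)%N.
  elim: n => [|n IH].
    by rewrite leqn0 => /eqP ->; rewrite [X in _ * X]big_geq// mulr0 addr0.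
  rewrite leq_eqVlt => /predU1P[<-|]; first by rewrite [X in _ * X]big_geq// mulr0 addr0.
  rewrite ltnS => mn; rewrite (@big_cat_nat _ _ _ (n * h)%N)//=; last by rewrite leq_mul2r leqnSn orbT.
  rewrite [in X in _ <= _ + X]big_nat_recr//= mulrDr addrA; apply: lerD; first exact: IH.
  rewrite -{1}[(n * h)%N]add0n big_addn mulSn addnK big_mkord.
  have -> : h%:R * C * al (n * h)%N = \sum_(i < h) (C * al (n * h)%N).
    by rewrite sumr_const card_ord -[RHS]mulr_natl mulrA.
  by apply: ler_sum => i _; rewrite addnC; exact: alC.
have [n nB] := div (\sum_(0 <= k < m0 * h) al k + h%:R * C * B).
exists (maxn n m0).
have hC : 0 < h%:R * C by rewrite mulr_gt0// ltr0n.
rewrite -(ler_pM2l hC) -(lerD2l (\sum_(0 <= k < m0 * h) al k)).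
apply: le_trans (bound _ (leq_maxr _ _)); apply: le_trans nB _.
rewrite -(big_mkord xpredT al).
have nn : (n <= maxn n m0 * h)%N by rewrite (leq_trans (leq_maxl n m0))// leq_pmulr.
by rewrite (@big_cat_nat _ _ _ n _ _ _ _ _ nn)//= lerDl sumr_ge0// => i _; exact: ltW.
Qed.

End Normalisation.

(** * Descent along blocks, for real sequences only *)

Section BlockDescent.
Context {R : realType}.
Variables (al s q inc : nat -> R) (q0 dl : nat -> nat -> R).
Variables (K lam alpha0 delta : R) (h : nat).
Hypotheses (al0 : forall t, 0 < al t) (s0 : forall t, 0 <= s t).
Hypotheses (K1 : 1 <= K) (h0 : (0 < h)%N) (lam0 : 0 < lam).
Hypotheses (alpha0_ge0 : 0 <= alpha0) (delta0 : 0 <= delta) (delta1 : delta < 2^-1).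
Let be t := al t `^ (2 * delta).
Hypothesis eventual : forall eps : R, 0 < eps -> eps <= 1 -> exists T0, forall t, (T0 <= t)%N ->
  [/\ al t <= eps, `|(al t.+1)^-1 - (al t)^-1 - alpha0| <= eps,
   s t.+1 <= s t - 2 * al t * q t + al t * eps * K * (s t + be t) &
   inc t <= eps ^+ 2 * (K * (s t + be t))].
Hypothesis qK : forall t, `|q t| <= K * s t.
Hypothesis dl0 : forall T, dl T T = 0.
Hypothesis dlS : forall T t, (T <= t)%N -> dl T t.+1 <= 2 * dl T t + 2 * inc t.
Hypothesis q0q : forall (eps : R) T t, 0 < eps -> eps <= 1 -> (T <= t)%N ->
  q0 T t <= q t + K * (eps * s T + eps^-1 * dl T t).
Hypothesis excite : forall mm, (lam + h%:R * alpha0 * delta) * s (mm * h)%N <=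
  \sum_(mm * h <= t < mm.+1 * h) q0 (mm * h)%N t.
Hypothesis al_div : forall B : R, exists n, B <= \sum_(k < n) al k.

Let C1 := ratio_const alpha0 h.
Let C1_ge0 : 0 <= C1. Proof. exact: ratio_const_ge0. Qed.
Let be0 t : 0 < be t. Proof. exact: powR_gt0. Qed.
Let p0 : 0 <= 2 * delta. Proof. by rewrite mulr_ge0. Qed.
Let p1 : 2 * delta <= 1. Proof. by have := delta1; lra. Qed.

Lemma block_bounds : exists2 C, 1 <= C & forall (eps : R) T0, 0 < eps -> eps <= 1 ->
  (forall t, (T0 <= t)%N ->
  [/\ al t <= eps, `|(al t.+1)^-1 - (al t)^-1 - alpha0| <= eps,
   s t.+1 <= s t - 2 * al t * q t + al t * eps * K * (s t + be t) &
   inc t <= eps ^+ 2 * (K * (s t + be t))]) ->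
  forall T j, (T0 <= T)%N -> (j <= h)%N ->
  s (T + j)%N <= C * (s T + eps * be T) /\
  s (T + j)%N <= s T - 2 * al T * (\sum_(i < j) q0 T (T + i)%N) +
    C * eps * al T * (s T + be T).
Proof.
have C2_ge0 : 0 <= 1 + C1 by rewrite addr_ge0.
(* [block_recursion] gives one constant per length; the sum over all lengths up to h dominates each.
   Full blocks serve the contraction, partial ones the times in between. *)
have /choice[Cf CfP] : forall j, exists C, 1 <= C /\ _ := fun j =>
  let: ex_intro2 C a b := block_recursion j K1 C1_ge0 C2_ge0 in ex_intro _ C (conj a b).
exists (\sum_(j < h.+1) Cf j).
  rewrite big_ord_recl (le_trans (CfP 0%N).1)// lerDl sumr_ge0// => j _.
  exact: le_trans ler01 (CfP _).1.
move=> eps T0 e0 e1 good T j TT jh.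
have good' t (Tt : (T <= t)%N) := good t (leq_trans TT Tt).
have al_eps t (Tt : (T <= t)%N) : al t <= eps by case: (good' t Tt).
have al_inv t (Tt : (T <= t)%N) : `|(al t.+1)^-1 - (al t)^-1 - alpha0| <= eps.
  by case: (good' t Tt).
have CfC : Cf j <= \sum_(j < h.+1) Cf j.
  have jh' : (j < h.+1)%N by [].
  rewrite (bigD1 (Ordinal jh'))//= lerDl sumr_ge0// => i _.
  exact: le_trans ler01 (CfP _).1.
have := (CfP j).2 (fun i => al (T + i)%N) (fun i => be (T + i)%N) (fun i => s (T + i)%N)
  (fun i => q (T + i)%N) (fun i => q0 T (T + i)%N) (fun i => dl T (T + i)%N) eps e0 e1.
rewrite !addn0 => /(_ (al0 T) (ltW (be0 T)) (fun i => s0 _) (dl0 T)).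
case.
- move=> i ij; have ih : (i <= h)%N := ltnW (leq_trans ij jh).
  split; [by rewrite al0 al_eps// leq_addr| | |exact: ltW].
  + exact: (al_pow_le al0 alpha0_ge0 p0 p1 e0 e1 al_eps al_inv ih).
  + exact: (al_dist al0 alpha0_ge0 e0 e1 al_eps al_inv ih).
- move=> i ij; have [_ _ S1 S2] := good' _ (leq_addr i T).
  rewrite addnS; split => //.
    apply: le_trans (dlS (leq_addr i T)) _.
    by rewrite lerD2l ler_pM2l.
  by apply: q0q => //; exact: leq_addr.
move=> Sa _ Sc; have sb : 0 <= s T + eps * be T.
  by rewrite addr_ge0// mulr_ge0// ltW.
have sb' : 0 <= eps * (al T * (s T + be T)).
  by rewrite mulr_ge0 ?(ltW e0)// mulr_ge0 ?(ltW (al0 T))// addr_ge0// ltW.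
split; first by apply: le_trans Sa _; rewrite ler_wpM2r.
apply: le_trans Sc _; by rewrite lerD2l -!mulrA ler_wpM2r.
Qed.

Lemma block_descent eps : 0 < eps -> exists T, forall t, (T <= t)%N -> s t <= eps * be t.
Proof.
move=> eps0; have [C C_ge1 CP] := block_bounds.
have C0 : 0 <= C by exact: le_trans C_ge1.
pose C3 := C + 2 * delta * h%:R + (2 * (lam + h%:R * alpha0 * delta) + C + C) *
       (2 * delta * (h%:R * (alpha0 + 1))) + C.
have C3_ge1 : 1 <= C3.
  have d0 : 0 <= delta * h%:R by rewrite mulr_ge0.
  have c0 : 0 <= h%:R * alpha0 * delta by rewrite !mulr_ge0.
  have Y0 : 0 <= 2 * delta * (h%:R * (alpha0 + 1)) by rewrite !mulr_ge0// addr_ge0.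
  have t1 : 0 <= 2 * (lam + h%:R * alpha0 * delta) + C + C by have := lam0; lra.
  by have := mulr_ge0 t1 Y0; rewrite /C3; lra.
have C3_gt0 : 0 < C3 by exact: lt_le_trans C3_ge1.
(* Growth inside a block, times the level reached at block starts plus 1 for the term eps b, times
   the variation of b inside the block. *)
pose M := C * (2 * C3 / lam + 1) * (1 + C1).
have x0 : 0 < 2 * C3 / lam + 1 by rewrite ltr_wpDl// divr_ge0 ?mulr_ge0 ?(ltW lam0)// ltW.
have M0 : 0 < M.
  by rewrite /M mulr_gt0 ?mulr_gt0 ?(lt_le_trans _ C_ge1)// ltr_wpDr.
(* In turn: e <= 1; errors consume at most one lam of the rate 2 lam; the contraction factor is
   nonnegative; the final bound is below eps. *)
pose e := Num.min (Num.min 1 (lam / C3)) (Num.min lam^-1 (eps / M)).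
have e0 : 0 < e.
  by rewrite !lt_min ltr01 (divr_gt0 lam0 C3_gt0) (divr_gt0 eps0 M0) invr_gt0 lam0.
have [e1 elam elam' eeps] : [/\ e <= 1, C3 * e <= lam, lam * e <= 1 & M * e <= eps].
  have : e <= e by []; rewrite {2}/e !le_min => /andP[/andP[h1 h2] /andP[h3 h4]].
  split => //; first by rewrite mulrC -ler_pdivlMr.
    by rewrite -ler_pdivlMl// mulr1.
  by rewrite mulrC -ler_pdivlMr.
have [T0 good] := eventual e0 e1.
have blk := CP e T0 e0 e1 good.
(* As h > 0, T0 can also serve as the first admissible block index. *)
have T0h m : (T0 <= m)%N -> (T0 <= m * h)%N.
  by move=> /leq_trans; apply; rewrite leq_pmulr.
have al_eps T : (T0 <= T)%N -> forall t, (T <= t)%N -> al t <= e.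
  by move=> TT t Tt; case: (good t (leq_trans TT Tt)).
have al_inv T : (T0 <= T)%N -> forall t, (T <= t)%N ->
    `|(al t.+1)^-1 - (al t)^-1 - alpha0| <= e.
  by move=> TT t Tt; case: (good t (leq_trans TT Tt)).
have [] := @contraction_small R (fun m => s (m * h)%N / be (m * h)%N)
  (fun m => al (m * h)%N) lam (C3 * e) T0 lam0 (mulr_gt0 C3_gt0 e0) (fun m => al0 _).
- by move=> m /T0h mT; rewrite (le_trans _ elam')// ler_wpM2l ?(ltW lam0)// (al_eps _ mT).
- move=> m /T0h mT; set T := (m * h)%N in mT *.
  have [_ Sc] := blk T h mT (leqnn h).
  have ET : (m.+1 * h = T + h)%N by rewrite mulSn addnC.
  have Eq : \sum_(i < h) q0 T (T + i)%N = \sum_(T <= t < m.+1 * h) q0 T t.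
    rewrite ET; move: (q0 T) => F.
    rewrite -[X in \sum_(X <= _ < _) _]add0n big_addn addKn big_mkord.
    by apply: eq_bigr => i _; rewrite addnC.
  have ex := excite m; rewrite -/T -Eq in ex.
  have {}Sc : s (T + h)%N <= s T - 2 * al T * ((lam + h%:R * alpha0 * delta) * s T) +
      C * e * al T * (s T + be T).
    apply: le_trans Sc _; rewrite lerD2r lerD2l lerN2 ler_wpM2l// mulr_ge0//.
    exact: ltW.
  have hb : be T <= (1 + 2 * delta * (h%:R * (alpha0 + e) * al T)) * be (T + h)%N.
    by apply: al_pow_sharp => //; exact: al_inv.
  have := normalised_step (al0 T) (al_eps _ mT T (leqnn T)) e1 (s0 T) (s0 _) (be0 T) (be0 _)
    lam0 alpha0_ge0 delta0 C0 Sc hb.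
  rewrite -ET -/C3 => /le_trans; apply.
  rewrite lerD2r ler_wpM2r ?divr_ge0// ?(ltW (be0 T))//.
  by have := ler_wpM2r (ltW (al0 T)) elam; lra.
- apply: (@block_sum_diverges _ _ _ _ (1 + C1)) => //; first by rewrite ltr_wpDr.
  move=> m j /T0h mT jh.
  exact: (al_le al0 alpha0_ge0 e0 e1 (al_eps _ mT) (al_inv _ mT) (ltnW jh)).
move=> m1 m01 m1P; exists (m1 * h)%N => t mt; pose m := (t %/ h)%N; pose j := (t %% h)%N.
have tE : t = (m * h + j)%N by rewrite /m /j -divn_eq.
have m1m : (m1 <= m)%N by rewrite /m leq_divRL.
have mT := T0h _ (leq_trans m01 m1m).
have jh : (j <= h)%N by apply: ltnW; rewrite /j ltn_mod.
have [Sa _] := blk _ _ mT jh; rewrite tE.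
apply: le_trans Sa _.
have := m1P _ m1m; set T := (m * h)%N in mT *.
rewrite mulrA ler_pdivrMr// => Z.
have bT : be T <= (1 + C1) * be (T + j)%N.
  exact: (al_pow_ge al0 alpha0_ge0 p0 p1 e0 e1 (al_eps _ mT) (al_inv _ mT) jh).
have sT : s T <= 2 * C3 / lam * e * be T.
  rewrite -(ler_pM2l lam0); apply: le_trans Z _.
  have -> : lam * (2 * C3 / lam * e * be T) = 2 * (C3 * e) * be T.
    by field; rewrite gt_eqF.
  by [].
apply: (@le_trans _ _ (C * ((2 * C3 / lam + 1) * e * be T))).
  by rewrite ler_wpM2l//; lra.
apply: (@le_trans _ _ (C * ((2 * C3 / lam + 1) * e * ((1 + C1) * be (T + j)%N)))).
  rewrite ler_wpM2l// ler_wpM2l// mulr_ge0 ?(ltW e0)// addr_ge0// divr_ge0 ?(ltW lam0)//.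
  by rewrite mulr_ge0// ltW.
have := ler_wpM2r (ltW (be0 (T + j)%N)) eeps; rewrite /M; lra.
Qed.

End BlockDescent.

(** * Conclusion *)

Section EventualSmallness.
Context {R : realType}.

Lemma near_inftyE (Q : nat -> Prop) : (\forall t \near \oo, Q t) ->
  exists T0, forall t, (T0 <= t)%N -> Q t.
Proof. by move=> [T0 _ QT]; exists T0 => t; exact: QT. Qed.

(** The factor al^(1 - 2 delta) tends to 0 because delta < 1/2. *)
Lemma near_le_powR (al : nat -> R) (delta eps : R) : (forall t, 0 < al t) ->
  al @ \oo --> (0 : R) -> delta < 2^-1 -> 0 < eps ->
  \forall t \near \oo, al t <= eps * al t `^ (2 * delta).
Proof.
move=> al0 al_cvg d1 eps0.
have r0 : 0 < 1 - 2 * delta by lra.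
have e'0 : 0 < eps `^ (1 - 2 * delta)^-1 by exact: powR_gt0.
move/cvgrPdist_le : al_cvg => /(_ _ e'0); apply: filterS => t.
rewrite sub0r normrN gtr0_norm// => ale.
have {1}-> : al t = al t `^ (1 - 2 * delta) * al t `^ (2 * delta).
  by rewrite -powRD ?subrK ?powRr1 ?(ltW (al0 t))// gt_eqF ?implybT.
rewrite ler_wpM2r ?powR_ge0//.
have := ge0_ler_powR (ltW r0) _ _ ale; rewrite -powRrM mulVf ?gt_eqF// powRr1 ?(ltW eps0)//.
by apply; rewrite nnegrE ?ltW// ltW.
Qed.

End EventualSmallness.

Unset Implicit Arguments.

Theorem theorem1
  (R : realType) (d : measure_display) (T : measurableType d) (P : probability T R)
  (N M : nat) (m : 'I_N -> nat)
  (a : 'I_N -> 'I_N -> R)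
  (ha_ge0 : forall i j, 0 <= a i j) (ha_diag : forall i, a i i = 0)
  (theta : 'cV[R]_M) (x0 : 'I_N -> 'cV[R]_M)
  (alphai f : 'I_N -> nat -> R)
  (halphai_gt0 : forall i t, 0 < alphai i t) (hf_ge0 : forall i t, 0 <= f i t)
  (H : nat -> forall i : 'I_N, T -> 'M[R]_(m i, M))
  (v : nat -> forall i : 'I_N, T -> 'cV[R]_(m i))
  (hH_meas : forall t i k l, measurable_fun setT (fun w => H t i w k l))
  (hv_meas : forall t i k, measurable_fun setT (fun w => v t i w k 0))
  (alpha : nat -> R) (alpha0 delta : R)
  (* Assumption 1 (i.a) *)
  (hA1 : forall i, (fun t => alphai i t / alpha t) @ \oo --> (1 : R))
  (hA2 : forall t, 0 < alpha t)
  (hA3 : alpha @ \oo --> (0 : R))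
  (hA4 : (fun n => \sum_(k < n) alpha k) @ \oo --> +oo)
  (hA5 : (fun t => (alpha t.+1)^-1 - (alpha t)^-1) @ \oo --> alpha0)
  (halpha0 : 0 <= alpha0)
  (* delta in [0, 1/2), common to (ii.c) and (iii.a) *)
  (hdelta0 : 0 <= delta) (hdelta1 : delta < 2^-1)
  (* Assumption 1 (ii.a) *)
  (hindep : indep_sigma P (sigma_H H) (sigma_V v))
  (* Assumption 1 (ii.b) *)
  (rho cV : R) (hrho : 2 < rho)
  (hmds : forall t i k,
     cond_exp_version P (filt_past H v t) (fun w => v t i w k 0) (fun _ => 0))
  (hmom : forall t, exists Y : T -> R,
     cond_exp_version_nonneg P (filt_past H v t)
       (fun w => enorm (stack (fun i => v t i w)) `^ rho) Y /\
     {ae P, forall w, Y w <= cV})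
  (* Assumption 1 (ii.c) *)
  (D : R)
  (hDH : {ae P, forall w, forall t, opnorm_sq_le (DH (fun i => H t i w)) D})
  (h : nat) (lambda : R) (hh : (0 < h)%N) (hlambda : 0 < lambda)
  (hPE : forall mm : nat, exists Y : nat -> T -> 'M[R]_(\sum_(i < N) M),
     (forall t, (mm * h <= t < mm.+1 * h)%N ->
        cond_exp_version_mx P (filt_past H v (mm * h))
          (fun w => kron_id M (lapbar a) +
                    DH (fun i => H t i w) *m (DH (fun i => H t i w))^T)
          (Y t)) /\
     (forall t w, (Y t w)^T = Y t w) /\
     {ae P, forall w, lambda_min_ge (\sum_(mm * h <= t < mm.+1 * h) Y t w)
                                    (lambda + h%:R * alpha0 * delta)})
  (* Assumption 1 (iii.a) *)
  (hf : (fun t => (\big[Num.max/0]_(i < N) f i t) / alpha t `^ delta) @ \oo --> (0 : R)) :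
  let e0 := fun t w =>
    stack (fun i => (et_state a x0 alphai f theta
                        (fun s j => H s j w) (fun s j => v s j w) t).1 i - theta) in
  (fun t => (\int[P]_w ((enorm (e0 t w) ^+ 2)%:E) *
             ((alpha t `^ (2 * delta))^-1)%:E)%E) @ \oo --> 0%E.
Proof.
move=> e0.
have mH t i : mxmeas (H t i) by move=> k l; exact: hH_meas.
have mv t i : mxmeas (v t i) by move=> k l; rewrite (ord1 l); exact: hv_meas.
pose E := err a x0 alphai f theta H v.
pose s t := mse P a x0 alphai f theta H v t.
pose K := step_const M a cV D.
pose q0 t0 t := EX P (fun w => dotv (E t0 w) (G a H t w *m E t0 w)).
pose dl t0 t := EX P (fun w => sqv (E t w - E t0 w)).
have E2 t : vL2 P (E t) := (err_mean_step_L2 x0 alphai theta ha_ge0 hf_ge0 mH mv hrho hmom hDH t).1.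
pose be t := alpha t `^ (2 * delta).
have be0 t : 0 < be t by exact: powR_gt0.
suff small eps : 0 < eps -> exists t0, forall t, (t0 <= t)%N -> s t <= eps * be t.
  have -> : (fun t => (\int[P]_w ((enorm (e0 t w) ^+ 2)%:E) *
      ((alpha t `^ (2 * delta))^-1)%:E)%E) = fun t => (s t / be t)%:E.
    apply/funext => t; rewrite EFinM; congr (_ * _)%E.
    have -> : (fun w => (enorm (e0 t w) ^+ 2)%:E) = (fun w => (sqv (E t w))%:E).
      by apply/funext => w; rewrite enorm_sq.
    exact: (EXE (E2 t).2).
  apply: cvg_EFin; first exact: nearW.
  apply/cvgrPdist_le => eps eps0; have [t0 st0] := small eps eps0.
  exists t0 => // t /= t0t; rewrite sub0r normrN ger0_norm.
    by rewrite ler_pdivrMr// st0.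
  by rewrite divr_ge0 ?mse_ge0// ltW.
apply: (@block_descent R alpha s (fun t => q0 t t) (fun t => dl t t.+1) q0 dl
  K lambda alpha0 delta h) => //.
- by move=> t; exact: mse_ge0.
- exact: step_const_ge1.
- move=> e e_gt0 e_le1.
  have n1 : \forall t \near \oo, alpha t <= e.
    move/cvgrPdist_le : hA3 => /(_ _ e_gt0); apply: filterS => t.
    by rewrite sub0r normrN gtr0_norm.
  have n2 := near_le_powR hA2 hA3 hdelta1 e_gt0.
  have n3 : \forall t \near \oo, `|(alpha t.+1)^-1 - (alpha t)^-1 - alpha0| <= e.
    by move/cvgrPdist_le : hA5 => /(_ _ e_gt0); apply: filterS => t; rewrite distrC.
  have n4 : \forall t \near \oo, forall i, `|alphai i t / alpha t - 1| <= e.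
    apply: filter_forall => i.
    by move/cvgrPdist_le : (hA1 i) => /(_ _ e_gt0); apply: filterS => t; rewrite distrC.
  have n5 : \forall t \near \oo, forall j, f j t ^+ 2 <= e ^+ 2 * be t.
    move/cvgrPdist_le : hf => /(_ _ e_gt0); apply: filterS => t.
    rewrite sub0r normrN => ft j.
    have ad : 0 < alpha t `^ delta by exact: powR_gt0.
    have fj : f j t <= e * alpha t `^ delta.
      rewrite -ler_pdivrMr//; apply: le_trans (le_trans (ler_norm _) ft).
      by rewrite ler_pM2r ?invr_gt0//; exact: le_bigmax.
    (* The thresholds are compared with alpha^delta and enter squared, whence b = alpha^(2
       delta). *)
    have -> : e ^+ 2 * be t = (e * alpha t `^ delta) ^+ 2.
      by rewrite exprMn /be [2 * delta]mulrC powRrM powR_mulrn ?powR_ge0.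
    rewrite ler_pXn2r ?nnegrE ?hf_ge0//; apply: mulr_ge0; exact: ltW. 
  have [t0 Ht0] := near_inftyE (filterI n1 (filterI n2 (filterI n3 (filterI n4 n5)))).
  exists t0 => t /Ht0[h1 [h2 [h3 [h4 h5]]]]; split => //.
  + exact: (mse_step x0 theta ha_ge0 hf_ge0 mH mv hindep hrho hmds hmom hDH (hA2 t) e_gt0 e_le1 (ltW (be0 t)) h1 h2 h4 h5).
  + exact: (increment_le x0 theta ha_ge0 hf_ge0 mH mv hrho hmom hDH (hA2 t) e_gt0 e_le1 (ltW (be0 t)) h1 h2 h4 h5).
- by move=> t; exact: quad_G_le.
- move=> t; rewrite /dl (_ : (fun w => _) = fun=> 0) ?EX_cst//.
  apply/funext => w; rewrite subrr /sqv/dotv big1// => k _.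
  by rewrite mxE mul0r.
- move=> t0 t t0t; rewrite /dl.
  have d1 := (vL2D (E2 t) (vL2N (E2 t0))).2; have d2 := (vL2D (E2 t.+1) (vL2N (E2 t))).2.
  have d3 := (vL2D (E2 t.+1) (vL2N (E2 t0))).2.
  rewrite -(EXZ _ d1) -(EXZ _ d2) -(EXD (integZ 2 d1) (integZ 2 d2)).
  apply: EX_le => //; first exact: integD (integZ 2 d1) (integZ 2 d2).
  apply: aeW => w; rewrite -(subrKA (E t w) (E t.+1 w)) addrC; exact: sqvD_le.
- move=> e t0 t e_gt0 e_le1 _.
  exact: (quad_base_change x0 alphai theta ha_ge0 hf_ge0 mH mv hrho hmom hDH t0 t e_gt0 e_le1).
- move=> mm.
  exact: (excitation x0 alphai theta ha_ge0 hf_ge0 mH mv hrho hmom hDH hPE mm).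
- move=> B; move/cvgryPge : hA4 => /(_ B) /near_inftyE[n nB].
  by exists n; exact: nB.
Qed.
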